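(* Consider a functional PTS specification, its EPTS and its Dedukti encoding. Let $\Gamma,A$ satisfy $\Gamma\vdash A\ type$, and let $T=\mathbf U_A$ if $A$ is a top-sort and $T=\mathbf{El}_{s_A}[\![A]\!]$ otherwise (where $\Gamma\vdash A:s_A$). Then $[\![-]\!]$ and $\lfloor-\rfloor$ give a bijection $$\Lambda(\Gamma\vdash_{EPTS}\_:A)\simeq\Lambda_{NF}([\![\Gamma]\!]\vdash_{DK}\_:T)/\equiv_H .$$ Moreover $[\![-]\!]$ commutes with substitution ($[\![M]\!]\{[\![N]\!]/x\}=[\![M\{N/x\}]\!]$), for EPTS terms $M,N$ one has $M\hookrightarrow^*N$ iff $[\![M]\!]\hookrightarrow^*[\![N]\!]$, and every Dedukti term $M$ with $[\![\Gamma]\!]\vdash_{DK}M:T$ has a $\beta$-normal form.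
   Context: $\Lambda(\Gamma\vdash_{EPTS}\_:A)$ is the set of EPTS terms $M$ with $\Gamma\vdash M:A$; $\Lambda_{NF}([\![\Gamma]\!]\vdash_{DK}\_:T)$ is the set of $\beta$-normal Dedukti terms $M$ with $[\![\Gamma]\!]\vdash_{DK}M:T$. Functional PTS specification $(\mathcal S,\mathcal A,\mathcal R)$ ($\mathcal A$ functional, $\mathcal R$ functional in first two components); top-sort: no $(s,s')\in\mathcal A$. EPTS terms $x\mid s\mid\Pi_{s_1,s_2}(A,x.B)\mid\lambda_{s_1,s_2}(A,x.B,x.M)\mid@_{s_1,s_2}(A,x.B,M,N)$; reduction: context closure of $@_{s_1,s_2}(A,x.B,\lambda_{s_1,s_2}(A',x.B',x.M),N)\hookrightarrow M\{N/x\}$, $(s_1,s_2,s_3)\in\mathcal R$. EPTS typing: standard rules Empty, Decl, Conv, Var, Sort ($(s_1,s_2)\in\mathcal A$ gives $s_1:s_2$), and for $(s_1,s_2,s_3)\in\mathcal R$: Prod ($A:s_1$, $x:A\vdash B:s_2$ give $\Pi_{s_1,s_2}(A,x.B):s_3$), Abs (plus $x:A\vdash M:B$ gives $\lambda_{s_1,s_2}(A,x.B,x.M):\Pi_{s_1,s_2}(A,x.B)$), App ($A:s_1$, $x:A\vdash B:s_2$, $N:A$, $M:\Pi_{s_1,s_2}(A,x.B)$ give $@_{s_1,s_2}(A,x.B,M,N):B\{N/x\}$). $\Gamma\vdash A\ type$: $\Gamma\vdash A:s$ for some $s$, or $A$ a top-sort with $\Gamma$ well-formed. Dedukti theory $(\Sigma_{EPTS},\mathscr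 R_{EPTS})$: $\mathbf U_s:\mathtt{TYPE}$, $\mathbf{El}_s[A:\mathbf U_s]:\mathtt{TYPE}$; for $(s_1,s_2)\in\mathcal A$: $\mathbf u_{s_1}:\mathbf U_{s_2}$ and rule $\mathbf{El}_{s_2}\mathbf u_{s_1}\hookrightarrow\mathbf U_{s_1}$; for $(s_1,s_2,s_3)\in\mathcal R$: $\mathbf{Prod}_{s_1,s_2}[A:\mathbf U_{s_1};B:\mathbf{El}_{s_1}A\to\mathbf U_{s_2}]:\mathbf U_{s_3}$, $\mathbf{abs}_{s_1,s_2}[A;B;M:\Pi x:\mathbf{El}_{s_1}A.\mathbf{El}_{s_2}(Bx)]:\mathbf{El}_{s_3}(\mathbf{Prod}_{s_1,s_2}AB)$, $\mathbf{app}_{s_1,s_2}[A;B;M:\mathbf{El}_{s_3}(\mathbf{Prod}_{s_1,s_2}AB);N:\mathbf{El}_{s_1}A]:\mathbf{El}_{s_2}(BN)$, rule $\mathbf{app}_{s_1,s_2}AB(\mathbf{abs}_{s_1,s_2}A'B'M)N\hookrightarrow MN$; $\vdash_{DK}$ is Dedukti typing (λΠ-calculus with constants, conversion modulo $\beta$ and these rules). Translation $[\![-]\!]$: $x\mapsto x$, $s\mapsto\mathbf u_s$, $\Pi_{s_1,s_2}(A,x.B)\mapsto\mathbf{Prod}_{s_1,s_2}[\![A]\!](\lambda x:\mathbf{El}_{s_1}[\![A]\!].[\![B]\!])$, $\lambda_{s_1,s_2}(A,x.B,x.M)\mapsto\mathbf{abs}_{s_1,s_2}[\![A]\!](\lambda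 x:\mathbf{El}_{s_1}[\![A]\!].[\![B]\!])(\lambda x:\mathbf{El}_{s_1}[\![A]\!].[\![M]\!])$, $@_{s_1,s_2}(A,x.B,M,N)\mapsto\mathbf{app}_{s_1,s_2}[\![A]\!](\lambda x:\mathbf{El}_{s_1}[\![A]\!].[\![B]\!])[\![M]\!][\![N]\!]$; $[\![\Gamma,x:A]\!]=[\![\Gamma]\!],x:\mathbf{El}_{s_A}[\![A]\!]$. Invertible forms: $M::=x\mid\mathbf u_s\mid\mathbf{abs}_{s_1,s_2}A(\lambda x:T_1.B)(\lambda x:T_2.M)\mid(\lambda x:T.M)N\mid\mathbf{Prod}_{s_1,s_2}A(\lambda x:T_1.B)\mid\mathbf{app}_{s_1,s_2}A(\lambda x:T_1.B)MN$ ($T$'s arbitrary); inverse translation $\lfloor-\rfloor$: $\lfloor x\rfloor=x$, $\lfloor\mathbf u_s\rfloor=s$, $\lfloor(\lambda x:T.M)N\rfloor=\lfloor M\rfloor\{\lfloor N\rfloor/x\}$, and $\mathbf{Prod},\mathbf{abs},\mathbf{app}$ forms sent to $\Pi,\lambda,@$ with the same sort indices, ignoring the binder annotations $T$ and applying $\lfloor-\rfloor$ to the bodies. $\equiv_H$ is the equivalence generated by steps $C(\lambda x:A.P)\hookrightarrow C(\lambda x:A'.P)$ with $A\hookrightarrow A'$. *)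

(* Defs.v *)
From Stdlib Require Export List Arith Relations.
Export ListNotations.
Set Implicit Arguments.
Unset Strict Implicit.

(** * Pure type system specifications *)

Record pts : Type := Pts {
  sort : Type;
  ax : sort -> sort -> Prop;
  rl : sort -> sort -> sort -> Prop }.

Definition functional (P : pts) : Prop :=
  (forall s s1 s2 : sort P, ax s s1 -> ax s s2 -> s1 = s2) /\
  (forall s1 s2 s3 s3' : sort P, rl s1 s2 s3 -> rl s1 s2 s3' -> s3 = s3').

Definition top_sort (P : pts) (s : sort P) : Prop := forall s', ~ ax s s'.

(** * Binding

    Both calculi use de Bruijn indices, so that equality is equality up to
    alpha-conversion.  A context is a list whose head is the most recent
    declaration, and the type of a declaration lives in the tail. *)

Definition up_ren (r : nat -> nat) (x : nat) : nat :=
  match x with 0 => 0 | S y => S (r y) end.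

(** * EPTS *)

Section EptsSyntax.

Variable P : pts.

Inductive eterm : Type :=
| EVar (x : nat)
| ESort (s : sort P)
| EPi (s1 s2 : sort P) (A B : eterm)
| ELam (s1 s2 : sort P) (A B M : eterm)
| EApp (s1 s2 : sort P) (A B M N : eterm).

Fixpoint eren (r : nat -> nat) (t : eterm) : eterm :=
  match t with
  | EVar x => EVar (r x)
  | ESort s => ESort s
  | EPi s1 s2 A B => EPi s1 s2 (eren r A) (eren (up_ren r) B)
  | ELam s1 s2 A B M =>
      ELam s1 s2 (eren r A) (eren (up_ren r) B) (eren (up_ren r) M)
  | EApp s1 s2 A B M N =>
      EApp s1 s2 (eren r A) (eren (up_ren r) B) (eren r M) (eren r N)
  end.

Definition eup (f : nat -> eterm) (x : nat) : eterm :=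
  match x with 0 => EVar 0 | S y => eren S (f y) end.

Fixpoint einst (f : nat -> eterm) (t : eterm) : eterm :=
  match t with
  | EVar x => f x
  | ESort s => ESort s
  | EPi s1 s2 A B => EPi s1 s2 (einst f A) (einst (eup f) B)
  | ELam s1 s2 A B M =>
      ELam s1 s2 (einst f A) (einst (eup f) B) (einst (eup f) M)
  | EApp s1 s2 A B M N =>
      EApp s1 s2 (einst f A) (einst (eup f) B) (einst f M) (einst f N)
  end.

(** [esubst x N M] is M{N/x}: the variable with index [x] disappears, so the
    indices above [x] are decremented. *)
Definition esubst (x : nat) (N M : eterm) : eterm :=
  einst (fun y => match Nat.compare y x with
                  | Lt => EVar y
                  | Eq => N
                  | Gt => EVar (pred y)
                  end) M.

Inductive ered : eterm -> eterm -> Prop :=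
| ered_beta s1 s2 s3 A B A' B' M N :
    rl s1 s2 s3 ->
    ered (EApp s1 s2 A B (ELam s1 s2 A' B' M) N) (esubst 0 N M)
| ered_pi1 s1 s2 A A' B : ered A A' -> ered (EPi s1 s2 A B) (EPi s1 s2 A' B)
| ered_pi2 s1 s2 A B B' : ered B B' -> ered (EPi s1 s2 A B) (EPi s1 s2 A B')
| ered_lam1 s1 s2 A A' B M :
    ered A A' -> ered (ELam s1 s2 A B M) (ELam s1 s2 A' B M)
| ered_lam2 s1 s2 A B B' M :
    ered B B' -> ered (ELam s1 s2 A B M) (ELam s1 s2 A B' M)
| ered_lam3 s1 s2 A B M M' :
    ered M M' -> ered (ELam s1 s2 A B M) (ELam s1 s2 A B M')
| ered_app1 s1 s2 A A' B M N :
    ered A A' -> ered (EApp s1 s2 A B M N) (EApp s1 s2 A' B M N)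
| ered_app2 s1 s2 A B B' M N :
    ered B B' -> ered (EApp s1 s2 A B M N) (EApp s1 s2 A B' M N)
| ered_app3 s1 s2 A B M M' N :
    ered M M' -> ered (EApp s1 s2 A B M N) (EApp s1 s2 A B M' N)
| ered_app4 s1 s2 A B M N N' :
    ered N N' -> ered (EApp s1 s2 A B M N) (EApp s1 s2 A B M N').

Definition ereds : relation eterm := clos_refl_trans eterm ered.
Definition econv : relation eterm := clos_refl_sym_trans eterm ered.

Inductive ewf : list eterm -> Prop :=
| ewf_empty : ewf []
| ewf_decl G A s : etyp G A (ESort s) -> ewf (A :: G)

with etyp : list eterm -> eterm -> eterm -> Prop :=
| etyp_var G x A :
    ewf G -> nth_error G x = Some A -> etyp G (EVar x) (eren (Nat.add (S x)) A)
| etyp_sort G s1 s2 : ewf G -> ax s1 s2 -> etyp G (ESort s1) (ESort s2)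
| etyp_conv G M A B s :
    etyp G M A -> etyp G B (ESort s) -> econv A B -> etyp G M B
| etyp_prod G s1 s2 s3 A B :
    rl s1 s2 s3 ->
    etyp G A (ESort s1) -> etyp (A :: G) B (ESort s2) ->
    etyp G (EPi s1 s2 A B) (ESort s3)
| etyp_abs G s1 s2 s3 A B M :
    rl s1 s2 s3 ->
    etyp G A (ESort s1) -> etyp (A :: G) B (ESort s2) -> etyp (A :: G) M B ->
    etyp G (ELam s1 s2 A B M) (EPi s1 s2 A B)
| etyp_app G s1 s2 s3 A B M N :
    rl s1 s2 s3 ->
    etyp G A (ESort s1) -> etyp (A :: G) B (ESort s2) ->
    etyp G M (EPi s1 s2 A B) -> etyp G N A ->
    etyp G (EApp s1 s2 A B M N) (esubst 0 N B).

(** The judgment "G |- A type". *)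
Definition eistype (G : list eterm) (A : eterm) : Prop :=
  (exists s, etyp G A (ESort s)) \/
  (exists s, A = ESort s /\ top_sort s /\ ewf G).

End EptsSyntax.

Arguments EVar {P} x.
Arguments ESort {P} s.

(** * Dedukti over the theory of the encoding

    Dedukti constants always occur applied to their full arity; each constant
    of the signature is therefore a constructor [CU], [CEl], ... taking its
    arguments.  As Dedukti syntax presupposes no typing, constants exist for
    all sorts, but only those declared in the signature are typable and only
    the rules of the theory reduce. *)

Section DeduktiSyntax.

Variable P : pts.

Inductive dterm : Type :=
| DVar (x : nat)
| DType
| DKind
| DApp (M N : dterm)
| DLam (A M : dterm)
| DPi (A B : dterm)
| CU (s : sort P)
| CEl (s : sort P) (A : dterm)
| Cu (s : sort P)
| CProd (s1 s2 : sort P) (A B : dterm)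
| Cabs (s1 s2 : sort P) (A B M : dterm)
| Capp (s1 s2 : sort P) (A B M N : dterm).

Fixpoint dren (r : nat -> nat) (t : dterm) : dterm :=
  match t with
  | DVar x => DVar (r x)
  | DType => DType
  | DKind => DKind
  | DApp M N => DApp (dren r M) (dren r N)
  | DLam A M => DLam (dren r A) (dren (up_ren r) M)
  | DPi A B => DPi (dren r A) (dren (up_ren r) B)
  | CU s => CU s
  | CEl s A => CEl s (dren r A)
  | Cu s => Cu s
  | CProd s1 s2 A B => CProd s1 s2 (dren r A) (dren r B)
  | Cabs s1 s2 A B M => Cabs s1 s2 (dren r A) (dren r B) (dren r M)
  | Capp s1 s2 A B M N =>
      Capp s1 s2 (dren r A) (dren r B) (dren r M) (dren r N)
  end.

Definition dup (f : nat -> dterm) (x : nat) : dterm :=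
  match x with 0 => DVar 0 | S y => dren S (f y) end.

Fixpoint dinst (f : nat -> dterm) (t : dterm) : dterm :=
  match t with
  | DVar x => f x
  | DType => DType
  | DKind => DKind
  | DApp M N => DApp (dinst f M) (dinst f N)
  | DLam A M => DLam (dinst f A) (dinst (dup f) M)
  | DPi A B => DPi (dinst f A) (dinst (dup f) B)
  | CU s => CU s
  | CEl s A => CEl s (dinst f A)
  | Cu s => Cu s
  | CProd s1 s2 A B => CProd s1 s2 (dinst f A) (dinst f B)
  | Cabs s1 s2 A B M => Cabs s1 s2 (dinst f A) (dinst f B) (dinst f M)
  | Capp s1 s2 A B M N =>
      Capp s1 s2 (dinst f A) (dinst f B) (dinst f M) (dinst f N)
  end.

Definition dsubst (x : nat) (N M : dterm) : dterm :=
  dinst (fun y => match Nat.compare y x with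
                  | Lt => DVar y
                  | Eq => N
                  | Gt => DVar (pred y)
                  end) M.

Definition darrow (A B : dterm) : dterm := DPi A (dren S B).

Inductive dclos (R : relation dterm) : relation dterm :=
| dclos_root M N : R M N -> dclos R M N
| dclos_app1 M M' N : dclos R M M' -> dclos R (DApp M N) (DApp M' N)
| dclos_app2 M N N' : dclos R N N' -> dclos R (DApp M N) (DApp M N')
| dclos_lam1 A A' M : dclos R A A' -> dclos R (DLam A M) (DLam A' M)
| dclos_lam2 A M M' : dclos R M M' -> dclos R (DLam A M) (DLam A M')
| dclos_pi1 A A' B : dclos R A A' -> dclos R (DPi A B) (DPi A' B)
| dclos_pi2 A B B' : dclos R B B' -> dclos R (DPi A B) (DPi A B')
| dclos_El s A A' : dclos R A A' -> dclos R (CEl s A) (CEl s A')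
| dclos_Prod1 s1 s2 A A' B :
    dclos R A A' -> dclos R (CProd s1 s2 A B) (CProd s1 s2 A' B)
| dclos_Prod2 s1 s2 A B B' :
    dclos R B B' -> dclos R (CProd s1 s2 A B) (CProd s1 s2 A B')
| dclos_abs1 s1 s2 A A' B M :
    dclos R A A' -> dclos R (Cabs s1 s2 A B M) (Cabs s1 s2 A' B M)
| dclos_abs2 s1 s2 A B B' M :
    dclos R B B' -> dclos R (Cabs s1 s2 A B M) (Cabs s1 s2 A B' M)
| dclos_abs3 s1 s2 A B M M' :
    dclos R M M' -> dclos R (Cabs s1 s2 A B M) (Cabs s1 s2 A B M')
| dclos_capp1 s1 s2 A A' B M N :
    dclos R A A' -> dclos R (Capp s1 s2 A B M N) (Capp s1 s2 A' B M N)
| dclos_capp2 s1 s2 A B B' M N :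
    dclos R B B' -> dclos R (Capp s1 s2 A B M N) (Capp s1 s2 A B' M N)
| dclos_capp3 s1 s2 A B M M' N :
    dclos R M M' -> dclos R (Capp s1 s2 A B M N) (Capp s1 s2 A B M' N)
| dclos_capp4 s1 s2 A B M N N' :
    dclos R N N' -> dclos R (Capp s1 s2 A B M N) (Capp s1 s2 A B M N').

Inductive beta_root : relation dterm :=
| beta_root_intro A M N : beta_root (DApp (DLam A M) N) (dsubst 0 N M).

Inductive rule_root : relation dterm :=
| rule_El s1 s2 : ax s1 s2 -> rule_root (CEl s2 (Cu s1)) (CU s1)
| rule_app s1 s2 s3 A B A' B' M N :
    rl s1 s2 s3 ->
    rule_root (Capp s1 s2 A B (Cabs s1 s2 A' B' M) N) (DApp M N).

Definition dbeta : relation dterm := dclos beta_root.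
Definition dred : relation dterm := dclos (union _ beta_root rule_root).

Definition dbetas : relation dterm := clos_refl_trans dterm dbeta.
Definition dreds : relation dterm := clos_refl_trans dterm dred.
Definition dconv : relation dterm := clos_refl_sym_trans dterm dred.

Definition beta_normal (M : dterm) : Prop := forall N, ~ dbeta M N.

Inductive H_root : relation dterm :=
| H_root_intro A A' M : dred A A' -> H_root (DLam A M) (DLam A' M).

Definition H_equiv : relation dterm := clos_refl_sym_trans dterm (dclos H_root).

Definition dsort (t : dterm) : Prop := t = DType \/ t = DKind.

(** The rules [dtyp_U] to [dtyp_capp] are the instances, for the declarations
    c[D] : T of the signature, of the rule deriving G |- c Ms : T{Ms} from
    G |- Ms : D. *)
Inductive dwf : list dterm -> Prop :=
| dwf_empty : dwf []
| dwf_decl G A : dtyp G A DType -> dwf (A :: G)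

with dtyp : list dterm -> dterm -> dterm -> Prop :=
| dtyp_type G : dwf G -> dtyp G DType DKind
| dtyp_var G x A :
    dwf G -> nth_error G x = Some A -> dtyp G (DVar x) (dren (Nat.add (S x)) A)
| dtyp_conv G M A B s :
    dtyp G M A -> dsort s -> dtyp G B s -> dconv A B -> dtyp G M B
| dtyp_pi G A B s :
    dsort s -> dtyp G A DType -> dtyp (A :: G) B s -> dtyp G (DPi A B) s
| dtyp_lam G A B M s :
    dsort s -> dtyp G A DType -> dtyp (A :: G) B s -> dtyp (A :: G) M B ->
    dtyp G (DLam A M) (DPi A B)
| dtyp_app G A B M N :
    dtyp G M (DPi A B) -> dtyp G N A -> dtyp G (DApp M N) (dsubst 0 N B)
| dtyp_U G s : dwf G -> dtyp G (CU s) DType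
| dtyp_El G s A : dtyp G A (CU s) -> dtyp G (CEl s A) DType
| dtyp_u G s1 s2 : ax s1 s2 -> dwf G -> dtyp G (Cu s1) (CU s2)
| dtyp_Prod G s1 s2 s3 A B :
    rl s1 s2 s3 ->
    dtyp G A (CU s1) -> dtyp G B (darrow (CEl s1 A) (CU s2)) ->
    dtyp G (CProd s1 s2 A B) (CU s3)
| dtyp_abs G s1 s2 s3 A B M :
    rl s1 s2 s3 ->
    dtyp G A (CU s1) -> dtyp G B (darrow (CEl s1 A) (CU s2)) ->
    dtyp G M (DPi (CEl s1 A) (CEl s2 (DApp (dren S B) (DVar 0)))) ->
    dtyp G (Cabs s1 s2 A B M) (CEl s3 (CProd s1 s2 A B))
| dtyp_capp G s1 s2 s3 A B M N :
    rl s1 s2 s3 ->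
    dtyp G A (CU s1) -> dtyp G B (darrow (CEl s1 A) (CU s2)) ->
    dtyp G M (CEl s3 (CProd s1 s2 A B)) -> dtyp G N (CEl s1 A) ->
    dtyp G (Capp s1 s2 A B M N) (CEl s2 (DApp B N)).

End DeduktiSyntax.

Arguments DVar {P} x.
Arguments DType {P}.
Arguments DKind {P}.
Arguments CU {P} s.
Arguments Cu {P} s.

(** * The translations *)

Section Translations.

Variable P : pts.

Fixpoint trans (t : eterm P) : dterm P :=
  match t with
  | EVar x => DVar x
  | ESort s => Cu s
  | EPi s1 s2 A B => CProd s1 s2 (trans A) (DLam (CEl s1 (trans A)) (trans B))
  | ELam s1 s2 A B M =>
      Cabs s1 s2 (trans A) (DLam (CEl s1 (trans A)) (trans B))
        (DLam (CEl s1 (trans A)) (trans M))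
  | EApp s1 s2 A B M N =>
      Capp s1 s2 (trans A) (DLam (CEl s1 (trans A)) (trans B))
        (trans M) (trans N)
  end.

(** The translation of contexts, as a relation: the sort [s] of [A] in [G] is
    unique when the specification is functional, and exists when the context
    is well-formed (see [trans_ctx_total] below). *)
Inductive trans_ctx : list (eterm P) -> list (dterm P) -> Prop :=
| trans_ctx_nil : trans_ctx [] []
| trans_ctx_cons G D A s :
    trans_ctx G D -> etyp G A (ESort s) ->
    trans_ctx (A :: G) (CEl s (trans A) :: D).

(** [trans_type G A T]: [T] is the Dedukti type associated with [A] when
    "G |- A type".  The cases are exclusive, a top-sort having no type. *)
Inductive trans_type (G : list (eterm P)) : eterm P -> dterm P -> Prop :=
| trans_type_top s : top_sort s -> trans_type G (ESort s) (CU s)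
| trans_type_El A s :
    etyp G A (ESort s) -> trans_type G A (CEl s (trans A)).

Definition map2o (X Y Z : Type) (f : X -> Y -> Z) (x : option X) (y : option Y)
  : option Z :=
  match x, y with Some x, Some y => Some (f x y) | _, _ => None end.

Definition apo (X Y : Type) (f : option (X -> Y)) (x : option X) : option Y :=
  map2o (fun g a => g a) f x.

(** The inverse translation; [None] outside the grammar of invertible forms. *)
Fixpoint inv (t : dterm P) : option (eterm P) :=
  match t with
  | DVar x => Some (EVar x)
  | Cu s => Some (ESort s)
  | CProd s1 s2 A (DLam _ B) => map2o (EPi s1 s2) (inv A) (inv B)
  | Cabs s1 s2 A (DLam _ B) (DLam _ M) =>
      apo (map2o (ELam s1 s2) (inv A) (inv B)) (inv M)
  | Capp s1 s2 A (DLam _ B) M N =>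
      apo (apo (map2o (@EApp P s1 s2) (inv A) (inv B)) (inv M)) (inv N)
  | DApp (DLam _ M) N => map2o (esubst 0) (inv N) (inv M)
  | _ => None
  end.

Lemma trans_ctx_total (G : list (eterm P)) :
  ewf G -> exists D, trans_ctx G D.
Proof.
assert (typ_wf : forall H M A, @etyp P H M A -> ewf H).
{ intros H M A h; induction h; assumption. }
induction G as [|A G IH]; intros wf.
- exists []; constructor.
- inversion wf as [|G' A' s hA]; subst.
  destruct (IH (typ_wf _ _ _ hA)) as [D hD].
  exists (CEl s (trans A) :: D); constructor; assumption.
Qed.

Lemma trans_type_total (G : list (eterm P)) A :
  eistype G A -> exists T, trans_type G A T.
Proof.
intros [[s hs]|[s [-> [hs _]]]].
- exists (CEl s (trans A)); now constructor.
- exists (CU s); now constructor.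
Qed.

End Translations.

(** [f] and the partial function [g] induce mutually inverse bijections between
    the set [X] and the quotient of the set [Y] by the equivalence [E]. *)
Definition bijection_mod (T U : Type) (X : T -> Prop) (Y : U -> Prop)
    (E : relation U) (f : T -> U) (g : U -> option T) : Prop :=
  (forall x, X x -> Y (f x)) /\
  (forall y, Y y -> exists x, g y = Some x /\ X x) /\
  (forall y y', Y y -> Y y' -> E y y' -> g y = g y') /\
  (forall x, X x -> g (f x) = Some x) /\
  (forall y x, Y y -> g y = Some x -> E (f x) y).

(* Main.v *)
(** All the metatheory is done on the Dedukti side.  The rules of the theory are
    orthogonal to beta, hence reduction is confluent; injectivity of products,
    subject reduction and uniqueness of types follow.  A Dedukti reduction of an
    invertible term induces an EPTS reduction of its inverse, so that the
    translation reflects reduction and conversion, and no metatheory of EPTS is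
    needed.

    Preservation of typing is by induction on EPTS derivations; in the
    conversion rule, convertible types have the same sort by confluence, subject
    reduction and uniqueness of types in Dedukti.  Conversely, a beta-normal
    term whose type is convertible to [CU s] or [CEl s A], in a context of such
    types, cannot be an application, and its arguments of product type are
    abstractions: it is invertible, and generation yields an EPTS derivation.
    The binder annotations are convertible to those of the translation, whence
    the quotient by H.

    Beta-normal forms exist because erasing dependencies maps typable terms to
    simply typed ones: the rules of the theory only identify types with the same
    erasure. *)

From Stdlib Require Import Lia Relations_2 Relations_2_facts Relations_3
  Relations_3_facts.
Require Import Defs.
Set Implicit Arguments.
Unset Strict Implicit.

(** * Closures of relations *)

Lemma clos_rt_map (X Y : Type) (R : relation X) (S : relation Y) (f : X -> Y) :
  (forall x y, R x y -> clos_refl_trans Y S (f x) (f y)) ->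
  forall x y, clos_refl_trans X R x y -> clos_refl_trans Y S (f x) (f y).
Proof. intros step x y; induction 1; eauto using clos_refl_trans. Qed.

Lemma clos_rst_map (X Y : Type) (R : relation X) (S : relation Y) (f : X -> Y) :
  (forall x y, R x y -> clos_refl_sym_trans Y S (f x) (f y)) ->
  forall x y,
  clos_refl_sym_trans X R x y -> clos_refl_sym_trans Y S (f x) (f y).
Proof. intros step x y; induction 1; eauto using clos_refl_sym_trans. Qed.

Lemma diamond_church_rosser (X : Type) (R S : relation X) :
  inclusion X R S -> inclusion X S (clos_refl_trans X R) ->
  Strongly_confluent X S ->
  forall x y, clos_refl_sym_trans X R x y ->
  exists z, clos_refl_trans X R x z /\ clos_refl_trans X R y z.
Proof.
intros RS SR diamond.
assert (confl := Strong_confluence X S diamond).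
assert (star : inclusion X (Rstar X S) (clos_refl_trans X R)).
{ intros x y; induction 1; eauto using clos_refl_trans. }
assert (coh : forall x y, clos_refl_sym_trans X R x y -> coherent X S x y).
{ induction 1 as [x y Rxy|x|x y _ IH|x y z _ [u [xu yu]] _ [v [yv zv]]].
  - apply Rstar_imp_coherent, Rstar_contains_R, RS, Rxy.
  - exists x; split; apply Rstar_reflexive.
  - apply coherent_symmetric, IH.
  - destruct (confl y u v yu yv) as [w [uw vw]].
    exists w; split; eapply Rstar_transitive; eassumption. }
intros x y xy; destruct (coh x y xy) as [z [xz yz]].
exists z; split; apply star; assumption.
Qed.

(** * Substitution *)

Section Substitution.

Variable P : pts.
Implicit Types (M N A B T : dterm P) (e : eterm P) (r : nat -> nat).

Definition scons (X : Type) (a : X) (f : nat -> X) (x : nat) : X :=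
  match x with 0 => a | S y => f y end.

Lemma dup_ext (f g : nat -> dterm P) :
  (forall x, f x = g x) -> forall x, dup f x = dup g x.
Proof. intros fg [|x]; simpl; [|rewrite fg]; auto. Qed.

Lemma eup_ext (f g : nat -> eterm P) :
  (forall x, f x = g x) -> forall x, eup f x = eup g x.
Proof. intros fg [|x]; simpl; [|rewrite fg]; auto. Qed.

Lemma dinst_ext M :
  forall f g, (forall x, f x = g x) -> dinst f M = dinst g M.
Proof. induction M; simpl; intros; f_equal; auto using dup_ext. Qed.

Lemma einst_ext e :
  forall f g, (forall x, f x = g x) -> einst f e = einst g e.
Proof. induction e; simpl; intros; f_equal; auto using eup_ext. Qed.

Lemma dinst_dren M :
  forall f r, dinst f (dren r M) = dinst (fun x => f (r x)) M.
Proof.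
induction M; simpl; intros; f_equal; auto;
  rewrite IHM2; apply dinst_ext; intros [|y]; reflexivity.
Qed.

Lemma dren_dinst_var M r : dren r M = dinst (fun x => DVar (r x)) M.
Proof.
revert r; induction M; simpl; intros; f_equal; auto;
  rewrite IHM2; apply dinst_ext; intros [|y]; reflexivity.
Qed.

Lemma dren_dren M r r' : dren r' (dren r M) = dren (fun x => r' (r x)) M.
Proof.
rewrite (dren_dinst_var (dren r M)), dinst_dren, dren_dinst_var; reflexivity.
Qed.

Lemma dren_dinst M :
  forall f r, dren r (dinst f M) = dinst (fun x => dren r (f x)) M.
Proof.
induction M; simpl; intros; f_equal; auto;
  rewrite IHM2; apply dinst_ext; intros [|y]; simpl; auto;
  rewrite !dren_dren; reflexivity.
Qed.

Lemma dinst_dinst M :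
  forall f g, dinst g (dinst f M) = dinst (fun x => dinst g (f x)) M.
Proof.
induction M; simpl; intros; f_equal; auto;
  rewrite IHM2; apply dinst_ext; intros [|y]; simpl; auto;
  rewrite dinst_dren, dren_dinst; reflexivity.
Qed.

Lemma dinst_var M : dinst (@DVar P) M = M.
Proof.
enough (pointwise : forall f, (forall x, f x = DVar x) -> dinst f M = M)
  by auto.
induction M; simpl; intros f f_var; f_equal; auto;
  apply IHM2; intros [|y]; simpl; auto; rewrite f_var; reflexivity.
Qed.

Lemma dsubst0E N M : dsubst 0 N M = dinst (scons N (@DVar P)) M.
Proof. apply dinst_ext; intros [|y]; reflexivity. Qed.

Lemma esubst0E (e e' : eterm P) : esubst 0 e e' = einst (scons e (@EVar P)) e'.
Proof. apply einst_ext; intros [|y]; reflexivity. Qed.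

Lemma dinst_dsubst0 f N M :
  dinst f (dsubst 0 N M) = dsubst 0 (dinst f N) (dinst (dup f) M).
Proof.
rewrite !dsubst0E, !dinst_dinst; apply dinst_ext; intros [|y]; simpl; auto.
rewrite dinst_dren; simpl; symmetry; apply dinst_var.
Qed.

Lemma dren_dsubst0 r N M :
  dren r (dsubst 0 N M) = dsubst 0 (dren r N) (dren (up_ren r) M).
Proof.
rewrite !(dren_dinst_var _ r), dinst_dsubst0; f_equal.
rewrite dren_dinst_var; apply dinst_ext; intros [|y]; reflexivity.
Qed.

Lemma dsubst0_dren N M : dsubst 0 N (dren S M) = M.
Proof. rewrite dsubst0E, dinst_dren; apply dinst_var. Qed.

Lemma dsubst0_up_ren M : dsubst 0 (DVar 0) (dren (up_ren S) M) = M.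
Proof.
rewrite dsubst0E, dinst_dren, <- dinst_var.
apply dinst_ext; intros [|y]; reflexivity.
Qed.

Lemma dinst_dup_dren f M : dinst (dup f) (dren S M) = dren S (dinst f M).
Proof. rewrite dinst_dren, dren_dinst; reflexivity. Qed.

Lemma dren_add_S n A : dren (Nat.add (S n)) A = dren S (dren (Nat.add n) A).
Proof. rewrite dren_dren; reflexivity. Qed.

Lemma trans_ren e : forall r, trans (eren r e) = dren r (trans e).
Proof. induction e; simpl; intros; repeat (f_equal; auto). Qed.

Lemma trans_inst e :
  forall f, trans (einst f e) = dinst (fun x => trans (f x)) (trans e).
Proof.
assert (trans_eup : forall (f : nat -> eterm P) x,
  trans (eup f x) = dup (fun y => trans (f y)) x).
{ intros f [|x]; simpl; auto; apply trans_ren. }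
assert (trans_inst_eup : forall (f : nat -> eterm P) e',
  (forall g, trans (einst g e') = dinst (fun x => trans (g x)) (trans e')) ->
  trans (einst (eup f) e') = dinst (dup (fun x => trans (f x))) (trans e')).
{ intros f e' IH; rewrite IH; apply dinst_ext, trans_eup. }
induction e; simpl; intros; repeat (f_equal; auto).
Qed.

Lemma trans_subst x (M N : eterm P) :
  dsubst x (trans N) (trans M) = trans (esubst x N M).
Proof.
unfold esubst; rewrite trans_inst; apply dinst_ext.
intros y; destruct (Nat.compare y x); reflexivity.
Qed.

Lemma inv_trans e : inv (trans e) = Some e.
Proof.
induction e; simpl; auto;
  repeat match goal with IH : inv _ = Some _ |- _ => rewrite IH; clear IH end;
  reflexivity.
Qed.

Lemma trans_inj (e e' : eterm P) : trans e = trans e' -> e = e'.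
Proof.
intros eq_trans; apply (f_equal (@inv P)) in eq_trans.
rewrite !inv_trans in eq_trans; congruence.
Qed.

Lemma einst_esubst0 f (e e' : eterm P) :
  einst f (esubst 0 e e') = esubst 0 (einst f e) (einst (eup f) e').
Proof.
apply trans_inj.
rewrite <- trans_subst, !trans_inst, <- trans_subst, dinst_dsubst0.
f_equal; apply dinst_ext; intros [|y]; simpl; auto; symmetry; apply trans_ren.
Qed.

Lemma eren_einst e r : eren r e = einst (fun x => EVar (r x)) e.
Proof.
apply trans_inj; rewrite trans_ren, trans_inst; apply dren_dinst_var.
Qed.

Lemma eren_esubst0 r (e e' : eterm P) :
  eren r (esubst 0 e e') = esubst 0 (eren r e) (eren (up_ren r) e').
Proof.
apply trans_inj.
rewrite trans_ren, <- !trans_subst, !trans_ren; apply dren_dsubst0.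
Qed.

End Substitution.

(** * Compatible relations *)

Section Compatible.

Variable P : pts.
Implicit Types (M N A B T : dterm P) (f g : nat -> dterm P).

Record compatible (E : relation (dterm P)) : Prop := {
  compat_app M M' N N' : E M M' -> E N N' -> E (DApp M N) (DApp M' N');
  compat_lam A A' M M' : E A A' -> E M M' -> E (DLam A M) (DLam A' M');
  compat_pi A A' B B' : E A A' -> E B B' -> E (DPi A B) (DPi A' B');
  compat_El s A A' : E A A' -> E (CEl s A) (CEl s A');
  compat_Prod s1 s2 A A' B B' :
    E A A' -> E B B' -> E (CProd s1 s2 A B) (CProd s1 s2 A' B');
  compat_abs s1 s2 A A' B B' M M' :
    E A A' -> E B B' -> E M M' -> E (Cabs s1 s2 A B M) (Cabs s1 s2 A' B' M');
  compat_capp s1 s2 A A' B B' M M' N N' :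
    E A A' -> E B B' -> E M M' -> E N N' ->
    E (Capp s1 s2 A B M N) (Capp s1 s2 A' B' M' N');
  compat_refl M : E M M }.

Definition one_hole_context (C : dterm P -> dterm P) : Prop :=
  forall R M N, dclos R M N -> dclos R (C M) (C N).

Lemma preorder_compatible (E : relation (dterm P)) :
  preorder _ E ->
  (forall C, one_hole_context C -> forall M N, E M N -> E (C M) (C N)) ->
  compatible E.
Proof.
intros [reflE transE] ctx; constructor; intros.
- apply transE with (DApp M' N);
    [apply (ctx (fun X => DApp X N)) | apply (ctx (DApp M'))];
    auto; red; auto using dclos.
- apply transE with (DLam A' M);
    [apply (ctx (fun X => DLam X M)) | apply (ctx (DLam A'))];
    auto; red; auto using dclos.
- apply transE with (DPi A' B);
    [apply (ctx (fun X => DPi X B)) | apply (ctx (DPi A'))];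
    auto; red; auto using dclos.
- apply (ctx (CEl s)); auto; red; auto using dclos.
- apply transE with (CProd s1 s2 A' B);
    [apply (ctx (fun X => CProd s1 s2 X B)) | apply (ctx (CProd s1 s2 A'))];
    auto; red; auto using dclos.
- apply transE with (Cabs s1 s2 A' B M);
    [|apply transE with (Cabs s1 s2 A' B' M)];
    [apply (ctx (fun X => Cabs s1 s2 X B M))
    |apply (ctx (fun X => Cabs s1 s2 A' X M))
    |apply (ctx (Cabs s1 s2 A' B'))];
    auto; red; auto using dclos.
- apply transE with (Capp s1 s2 A' B M N);
    [|apply transE with (Capp s1 s2 A' B' M N);
    [|apply transE with (Capp s1 s2 A' B' M' N)]];
    [apply (ctx (fun X => Capp s1 s2 X B M N))
    |apply (ctx (fun X => Capp s1 s2 A' X M N))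
    |apply (ctx (fun X => Capp s1 s2 A' B' X N))
    |apply (ctx (Capp s1 s2 A' B' M'))];
    auto; red; auto using dclos.
- apply reflE.
Qed.

Lemma clos_rt_compatible (R : relation (dterm P)) :
  compatible (clos_refl_trans _ (dclos R)).
Proof.
apply preorder_compatible; [apply clos_rt_is_preorder|].
intros C ctx; apply clos_rt_map; auto using rt_step.
Qed.

Lemma clos_rst_compatible (R : relation (dterm P)) :
  compatible (clos_refl_sym_trans _ (dclos R)).
Proof.
apply preorder_compatible.
- destruct (clos_rst_is_equiv _ (dclos R)); constructor; assumption.
- intros C ctx; apply clos_rst_map; auto using rst_step.
Qed.

Lemma dclos_inst (R : relation (dterm P)) :
  (forall f M N, R M N -> R (dinst f M) (dinst f N)) ->
  forall M N, dclos R M N -> forall f, dclos R (dinst f M) (dinst f N).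
Proof. intros root M N; induction 1; simpl; auto using dclos. Qed.

Lemma compatible_inst (E : relation (dterm P)) :
  compatible E -> (forall M N, E M N -> E (dren S M) (dren S N)) ->
  forall M f g, (forall x, E (f x) (g x)) -> E (dinst f M) (dinst g M).
Proof.
intros compat shift.
assert (compat_dup : forall f g,
  (forall x, E (f x) (g x)) -> forall x, E (dup f x) (dup g x)).
{ intros f g fg [|x]; simpl; [apply (compat_refl compat) | apply shift, fg]. }
induction M; simpl; intros; try apply (compat_refl compat); auto;
  apply compat; auto.
Qed.

Lemma dred_inst M N : dred M N -> forall f, dred (dinst f M) (dinst f N).
Proof.
apply dclos_inst; intros f A B [root|root]; [left|right]; destruct root; simpl.
- rewrite dinst_dsubst0; constructor.
- constructor; assumption.
- econstructor; eassumption.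
Qed.

Lemma dred_beta A M N : dred (DApp (DLam A M) N) (dsubst 0 N M).
Proof. constructor; left; constructor. Qed.

Lemma dconv_refl M : dconv M M.
Proof. apply rst_refl. Qed.

Lemma dconv_sym M N : dconv M N -> dconv N M.
Proof. apply rst_sym. Qed.

Lemma dconv_trans M N T : dconv M N -> dconv N T -> dconv M T.
Proof. apply rst_trans. Qed.

Lemma dred_dconv M N : dred M N -> dconv M N.
Proof. apply rst_step. Qed.

Lemma dreds_dconv M N : dreds M N -> dconv M N.
Proof. apply clos_rt_clos_rst. Qed.

Lemma dreds_common_dconv M N T : dreds M T -> dreds N T -> dconv M N.
Proof. eauto using dconv_trans, dconv_sym, dreds_dconv. Qed.

Lemma dconv_inst M N f : dconv M N -> dconv (dinst f M) (dinst f N).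
Proof.
apply (clos_rst_map (f := dinst f)).
intros; apply rst_step, dred_inst; assumption.
Qed.

Lemma dconv_ren M N r : dconv M N -> dconv (dren r M) (dren r N).
Proof. rewrite !dren_dinst_var; apply dconv_inst. Qed.

Lemma dconv_subst M M' N N' :
  dconv M M' -> dconv N N' -> dconv (dsubst 0 N M) (dsubst 0 N' M').
Proof.
intros convM convN; rewrite !dsubst0E.
apply dconv_trans with (dinst (scons N (@DVar P)) M');
  [apply dconv_inst, convM|].
apply (compatible_inst (clos_rst_compatible _)).
- intros; apply dconv_ren; assumption.
- intros [|x]; [exact convN | apply rst_refl].
Qed.

Lemma dconv_beta A M N : dconv (DApp (DLam A M) N) (dsubst 0 N M).
Proof. apply rst_step, dred_beta. Qed.

Lemma dconv_apply_var A M : dconv (DApp (dren S (DLam A M)) (DVar 0)) M.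
Proof. rewrite <- (dsubst0_up_ren M) at 2; apply dconv_beta. Qed.

Lemma dconv_app M M' N N' :
  dconv M M' -> dconv N N' -> dconv (DApp M N) (DApp M' N').
Proof. apply clos_rst_compatible. Qed.

Lemma dconv_pi A A' B B' :
  dconv A A' -> dconv B B' -> dconv (DPi A B) (DPi A' B').
Proof. apply clos_rst_compatible. Qed.

Lemma dconv_El s A A' : dconv A A' -> dconv (CEl s A) (CEl s A').
Proof. apply clos_rst_compatible. Qed.

Lemma dconv_Prod s1 s2 A A' B B' :
  dconv A A' -> dconv B B' -> dconv (CProd s1 s2 A B) (CProd s1 s2 A' B').
Proof. apply clos_rst_compatible. Qed.

Lemma dconv_El_u (s1 s2 : sort P) : ax s1 s2 -> dconv (CEl s2 (Cu s1)) (CU s1).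
Proof. intros; apply rst_step; constructor; right; constructor; assumption. Qed.

Lemma H_equiv_dconv M N : H_equiv M N -> dconv M N.
Proof.
apply (clos_rst_map (f := fun x => x)); intros x y step; apply rst_step.
induction step as [M' N' []| | | | | | | | | | | | | | | |];
  unfold dred in *; auto using dclos.
Qed.

Lemma H_equiv_lam A A' M M' :
  dconv A A' -> H_equiv M M' -> H_equiv (DLam A M) (DLam A' M').
Proof.
intros convA equivM; apply rst_trans with (DLam A' M).
- revert convA; apply (clos_rst_map (f := fun X => DLam X M)); intros.
  apply rst_step; constructor; constructor; assumption.
- apply (compat_lam (clos_rst_compatible _)); [apply rst_refl | assumption].
Qed.

End Compatible.

Ltac destruct_facts :=
  repeat match goal with
  | fact : exists _, _ |- _ => destruct fact
  | fact : _ /\ _ |- _ => destruct fact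
  | fact : _ \/ _ |- _ => destruct fact
  end.

Ltac invert_dred step :=
  inversion step; subst;
  try match goal with
  | root : union _ _ _ _ _ |- _ => destruct root as [root|root]
  end;
  try match goal with
  | root : beta_root _ _ |- _ => inversion root; subst
  | root : rule_root _ _ |- _ => inversion root; subst
  end.

(** * Reduction of invertible terms *)

Section Inversion.

Variable P : pts.
Implicit Types (M N A B T : dterm P) (e a b m n : eterm P).

Inductive invertible : dterm P -> eterm P -> Prop :=
| invertible_var x : invertible (DVar x) (EVar x)
| invertible_u s : invertible (Cu s) (ESort s)
| invertible_Prod s1 s2 A a T B b :
    invertible A a -> invertible B b ->
    invertible (CProd s1 s2 A (DLam T B)) (EPi s1 s2 a b)
| invertible_abs s1 s2 A a T B b T' M m :
    invertible A a -> invertible B b -> invertible M m ->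
    invertible (Cabs s1 s2 A (DLam T B) (DLam T' M)) (ELam s1 s2 a b m)
| invertible_capp s1 s2 A a T B b M m N n :
    invertible A a -> invertible B b -> invertible M m -> invertible N n ->
    invertible (Capp s1 s2 A (DLam T B) M N) (EApp s1 s2 a b m n)
| invertible_app T M m N n :
    invertible M m -> invertible N n ->
    invertible (DApp (DLam T M) N) (esubst 0 n m).

Lemma invertible_inv M e : invertible M e -> inv M = Some e.
Proof.
induction 1; simpl; auto;
  repeat match goal with IH : inv _ = Some _ |- _ => rewrite IH; clear IH end;
  reflexivity.
Qed.

Lemma invertible_trans e : invertible (trans e) e.
Proof. induction e; simpl; constructor; assumption. Qed.

Lemma invertible_ren M e :
  invertible M e -> forall r, invertible (dren r M) (eren r e).
Proof.
induction 1; simpl; intros; rewrite ?eren_esubst0; constructor; auto.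
Qed.

Lemma invertible_inst M e : invertible M e ->
  forall f g, (forall x, invertible (f x) (g x)) ->
  invertible (dinst f M) (einst g e).
Proof.
assert (invertible_up : forall f g, (forall x, invertible (f x) (g x)) ->
  forall x, invertible (dup f x) (eup g x)).
{ intros f g fg [|x]; simpl; [constructor | apply invertible_ren; auto]. }
induction 1; simpl; intros; rewrite ?einst_esubst0; auto; constructor; auto.
Qed.

Lemma invertible_subst M m N n :
  invertible M m -> invertible N n -> invertible (dsubst 0 N M) (esubst 0 n m).
Proof.
intros invM invN; rewrite dsubst0E, esubst0E.
apply invertible_inst; [assumption|].
intros [|x]; simpl; [assumption | constructor].
Qed.

Lemma ereds_refl e : ereds e e.
Proof. apply rt_refl. Qed.

Lemma ereds_trans e e' e'' : ereds e e' -> ereds e' e'' -> ereds e e''.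
Proof. apply rt_trans. Qed.

Lemma ereds_context (C : eterm P -> eterm P) :
  (forall e e', ered e e' -> ered (C e) (C e')) ->
  forall e e', ereds e e' -> ereds (C e) (C e').
Proof. intros ctx; apply clos_rt_map; auto using rt_step. Qed.

Lemma ereds_pi s1 s2 a a' b b' :
  ereds a a' -> ereds b b' -> ereds (EPi s1 s2 a b) (EPi s1 s2 a' b').
Proof.
intros; apply ereds_trans with (EPi s1 s2 a' b);
  [apply (@ereds_context (fun X => EPi s1 s2 X b))
  |apply (@ereds_context (EPi s1 s2 a'))];
  try assumption; intros; constructor; assumption.
Qed.

Lemma ereds_lam s1 s2 a a' b b' m m' :
  ereds a a' -> ereds b b' -> ereds m m' ->
  ereds (ELam s1 s2 a b m) (ELam s1 s2 a' b' m').
Proof.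
intros; apply ereds_trans with (ELam s1 s2 a' b m);
  [|apply ereds_trans with (ELam s1 s2 a' b' m)];
  [apply (@ereds_context (fun X => ELam s1 s2 X b m))
  |apply (@ereds_context (fun X => ELam s1 s2 a' X m))
  |apply (@ereds_context (ELam s1 s2 a' b'))];
  try assumption; intros; constructor; assumption.
Qed.

Lemma ereds_app s1 s2 a a' b b' m m' n n' :
  ereds a a' -> ereds b b' -> ereds m m' -> ereds n n' ->
  ereds (EApp s1 s2 a b m n) (EApp s1 s2 a' b' m' n').
Proof.
intros; apply ereds_trans with (EApp s1 s2 a' b m n);
  [|apply ereds_trans with (EApp s1 s2 a' b' m n);
  [|apply ereds_trans with (EApp s1 s2 a' b' m' n)]];
  [apply (@ereds_context (fun X => EApp s1 s2 X b m n))
  |apply (@ereds_context (fun X => EApp s1 s2 a' X m n))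
  |apply (@ereds_context (fun X => EApp s1 s2 a' b' X n))
  |apply (@ereds_context (EApp s1 s2 a' b' m'))];
  try assumption; intros; constructor; assumption.
Qed.

Lemma ered_inst e e' : ered e e' -> forall f, ered (einst f e) (einst f e').
Proof.
induction 1; simpl; intros; try (constructor; auto; fail).
rewrite einst_esubst0; econstructor; eassumption.
Qed.

Lemma ereds_inst e : forall f g,
  (forall x, ereds (f x) (g x)) -> ereds (einst f e) (einst g e).
Proof.
assert (ereds_up : forall f g : nat -> eterm P,
  (forall x, ereds (f x) (g x)) -> forall x, ereds (eup f x) (eup g x)).
{ intros f g fg [|x]; simpl; [apply rt_refl|].
  apply (@ereds_context (eren S)); [|apply fg].
  intros; rewrite !eren_einst; apply ered_inst; assumption. }
induction e; simpl; intros;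
  auto using ereds_refl, ereds_pi, ereds_lam, ereds_app.
Qed.

Lemma ereds_subst m m' n n' :
  ereds m m' -> ereds n n' -> ereds (esubst 0 n m) (esubst 0 n' m').
Proof.
intros redm redn; rewrite !esubst0E.
apply ereds_trans with (einst (scons n (@EVar P)) m').
- apply ereds_context with (2 := redm); intros; apply ered_inst; assumption.
- apply ereds_inst; intros [|x]; simpl; auto using ereds_refl.
Qed.

Lemma invertible_dred M e : invertible M e ->
  forall M', dred M M' -> exists e', invertible M' e' /\ ereds e e'.
Proof.
induction 1; intros Q step; invert_dred step;
  repeat match goal with
  | lam_step : dclos _ (DLam _ _) _ |- _ => invert_dred lam_step; clear lam_step
  end;
  repeat match goal with
  | IH : forall M', dred ?M M' -> _, stepM : dclos _ ?M _ |- _ =>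
      destruct (IH _ stepM) as [? [? ?]]; clear IH
  end;
  try (eexists; split; [constructor; eassumption|];
       eauto using ereds_refl, ereds_pi, ereds_lam, ereds_app, ereds_subst;
       fail).
- match goal with inv_abs : invertible (Cabs _ _ _ _ _) _ |- _ =>
    inversion inv_abs; subst end.
  eexists; split; [constructor; eassumption|].
  apply rt_step; econstructor; eassumption.
- eexists; split; [apply invertible_subst; eassumption | apply rt_refl].
Qed.

Lemma invertible_dreds M M' : dreds M M' ->
  forall e, invertible M e -> exists e', invertible M' e' /\ ereds e e'.
Proof.
induction 1 as [M M' step|M|M N M' _ IHM _ IHN]; intros e invM.
- eapply invertible_dred; eassumption.
- exists e; split; [assumption | apply rt_refl].
- destruct (IHM _ invM) as [n [invN redM]], (IHN _ invN) as [m' [invM' redN]].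
  exists m'; split; [assumption | eapply rt_trans; eassumption].
Qed.

Lemma trans_ered e e' : ered e e' -> dreds (trans e) (trans e').
Proof.
assert (compat := clos_rt_compatible (union _ (@beta_root P) (@rule_root P))).
induction 1; simpl;
  repeat first [assumption | apply (compat_refl compat) | apply compat].
rewrite <- trans_subst.
eapply rt_trans; apply rt_step; [|apply dred_beta].
constructor; right; econstructor; eassumption.
Qed.

Lemma ereds_iff_dreds e e' : ereds e e' <-> dreds (trans e) (trans e').
Proof.
split; [apply clos_rt_map, trans_ered|].
intros red.
destruct (invertible_dreds red (invertible_trans e)) as [reduct [inv_e' red_e]].
apply invertible_inv in inv_e'; rewrite inv_trans in inv_e'; congruence.
Qed.

Lemma trans_econv e e' : econv e e' -> dconv (trans e) (trans e').
Proof.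
apply clos_rst_map; intros; apply dreds_dconv, trans_ered; assumption.
Qed.

Definition inv_body (M : dterm P) : option (eterm P) :=
  match M with DLam _ N => inv N | _ => None end.

Lemma inv_app M N : inv (DApp M N) = map2o (esubst 0) (inv N) (inv_body M).
Proof. destruct M; simpl; destruct (inv N); reflexivity. Qed.

Lemma inv_Prod s1 s2 A B :
  inv (CProd s1 s2 A B) = map2o (EPi s1 s2) (inv A) (inv_body B).
Proof. destruct B; simpl; destruct (inv A); reflexivity. Qed.

Lemma inv_abs s1 s2 A B M :
  inv (Cabs s1 s2 A B M) =
  apo (map2o (ELam s1 s2) (inv A) (inv_body B)) (inv_body M).
Proof.
destruct B, M; simpl; destruct (inv A); try reflexivity;
  match goal with |- _ = apo (map2o _ _ ?o) _ => destruct o; reflexivity end.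
Qed.

Lemma inv_capp s1 s2 A B M N :
  inv (Capp s1 s2 A B M N) =
  apo (apo (map2o (@EApp P s1 s2) (inv A) (inv_body B)) (inv M)) (inv N).
Proof. destruct B; simpl; destruct (inv A); reflexivity. Qed.

Lemma inv_H_step M M' :
  dclos (@H_root P) M M' -> inv M = inv M' /\ inv_body M = inv_body M'.
Proof.
induction 1 as [M N []| | | | | | | | | | | | | | | |];
  destruct_facts; split; rewrite ?inv_app, ?inv_Prod, ?inv_abs, ?inv_capp;
  simpl; congruence.
Qed.

Lemma inv_H_equiv M M' : H_equiv M M' -> inv M = inv M'.
Proof.
induction 1 as [M M' step| | |]; [apply inv_H_step, step | congruence..].
Qed.

End Inversion.

(** * Confluence *)

Section Confluence.

Variable P : pts.
Implicit Types (M N A B T : dterm P).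

Inductive dpar : dterm P -> dterm P -> Prop :=
| dpar_var x : dpar (DVar x) (DVar x)
| dpar_type : dpar DType DType
| dpar_kind : dpar DKind DKind
| dpar_app M M' N N' : dpar M M' -> dpar N N' -> dpar (DApp M N) (DApp M' N')
| dpar_lam A A' M M' : dpar A A' -> dpar M M' -> dpar (DLam A M) (DLam A' M')
| dpar_pi A A' B B' : dpar A A' -> dpar B B' -> dpar (DPi A B) (DPi A' B')
| dpar_U s : dpar (CU s) (CU s)
| dpar_El s A A' : dpar A A' -> dpar (CEl s A) (CEl s A')
| dpar_u s : dpar (Cu s) (Cu s)
| dpar_Prod s1 s2 A A' B B' :
    dpar A A' -> dpar B B' -> dpar (CProd s1 s2 A B) (CProd s1 s2 A' B')
| dpar_abs s1 s2 A A' B B' M M' :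
    dpar A A' -> dpar B B' -> dpar M M' ->
    dpar (Cabs s1 s2 A B M) (Cabs s1 s2 A' B' M')
| dpar_capp s1 s2 A A' B B' M M' N N' :
    dpar A A' -> dpar B B' -> dpar M M' -> dpar N N' ->
    dpar (Capp s1 s2 A B M N) (Capp s1 s2 A' B' M' N')
| dpar_beta A M M' N N' :
    dpar M M' -> dpar N N' -> dpar (DApp (DLam A M) N) (dsubst 0 N' M')
| dpar_rule_El s1 s2 : ax s1 s2 -> dpar (CEl s2 (Cu s1)) (CU s1)
| dpar_rule_app s1 s2 s3 A B A' B' M M' N N' :
    rl s1 s2 s3 -> dpar M M' -> dpar N N' ->
    dpar (Capp s1 s2 A B (Cabs s1 s2 A' B' M) N) (DApp M' N').

Lemma dpar_refl M : dpar M M.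
Proof. induction M; constructor; assumption. Qed.

Lemma dred_dpar : inclusion _ (@dred P) dpar.
Proof.
intros M N; induction 1 as [M N [root|root]| | | | | | | | | | | | | | | |];
  try (constructor; auto using dpar_refl; fail);
  destruct root; econstructor; eauto using dpar_refl.
Qed.

Lemma dpar_dreds : inclusion _ dpar (@dreds P).
Proof.
assert (compat := clos_rt_compatible (union _ (@beta_root P) (@rule_root P))).
intros M N; induction 1;
  try first [apply (compat_refl compat) | apply compat; assumption].
- apply rt_trans with (DApp (DLam A M') N'); [|apply rt_step, dred_beta].
  apply (compat_app compat); [apply (compat_lam compat)|]; auto.
  apply (compat_refl compat).
- apply rt_step; constructor; right; constructor; assumption.
- apply rt_trans with (DApp M N); [|apply (compat_app compat); assumption].
  apply rt_step; constructor; right; econstructor; eassumption.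
Qed.

Lemma dpar_ren M N : dpar M N -> forall r, dpar (dren r M) (dren r N).
Proof.
induction 1; simpl; intros; rewrite ?dren_dsubst0; econstructor; eauto.
Qed.

Lemma dpar_inst M N : dpar M N ->
  forall f g, (forall x, dpar (f x) (g x)) -> dpar (dinst f M) (dinst g N).
Proof.
assert (dpar_dup : forall f g,
  (forall x, dpar (f x) (g x)) -> forall x, dpar (dup f x) (dup g x)).
{ intros f g fg [|x]; simpl; [constructor | apply dpar_ren; auto]. }
induction 1; simpl; intros; rewrite ?dinst_dsubst0; auto; econstructor; eauto.
Qed.

Lemma dpar_subst M M' N N' :
  dpar M M' -> dpar N N' -> dpar (dsubst 0 N M) (dsubst 0 N' M').
Proof.
intros parM parN; rewrite !dsubst0E; apply dpar_inst; auto.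
intros [|x]; simpl; auto using dpar_refl.
Qed.

Ltac join_reducts :=
  repeat match goal with
  | IH : forall N2, dpar ?M N2 -> exists N, dpar _ N /\ dpar N2 N,
    par : dpar ?M ?N |- _ =>
      destruct (IH _ par) as [? [? ?]]; clear IH
  end.

Lemma dpar_diamond : Strongly_confluent _ dpar.
Proof.
intros M N1 N2 par1; revert N2.
induction par1 as [x| | |M M' N N' parM IHM parN IHN|A A' M M' _ IHA _ IHM
  |A A' B B' _ IHA _ IHB|s|s A A' parA IHA|s|s1 s2 A A' B B' _ IHA _ IHB
  |s1 s2 A A' B B' M M' _ IHA _ IHB _ IHM
  |s1 s2 A A' B B' M M' N N' _ IHA _ IHB parM IHM parN IHN
  |A M M' N N' parM IHM parN IHN|s1 s2 ax12
  |s1 s2 s3 A B A' B' M M' N N' rl123 parM IHM parN IHN];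
  intros Q par2; inversion par2; subst;
  try (join_reducts; eexists; split; econstructor; eassumption).
- inversion parM; subst.
  destruct (IHM (DLam A M'0)) as [Q [parQ1 parQ2]];
    [constructor; auto using dpar_refl|].
  inversion parQ1; subst; inversion parQ2; subst; join_reducts.
  eexists; split; [constructor; eassumption | apply dpar_subst; eassumption].
- inversion parA; subst.
  eexists; split; [constructor; assumption | constructor].
- inversion parM; subst.
  destruct (IHM (Cabs s1 s2 A'0 B'0 M'0)) as [Q [parQ1 parQ2]];
    [constructor; auto using dpar_refl|].
  inversion parQ1; subst; inversion parQ2; subst; join_reducts.
  eexists; split; [econstructor; eassumption | constructor; eassumption].
- match goal with par : dpar (DLam _ _) _ |- _ => inversion par; subst end.
  join_reducts.
  eexists; split; [apply dpar_subst; eassumption | constructor; eassumption].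
- join_reducts; eexists; split; apply dpar_subst; eassumption.
- match goal with par : dpar (Cu _) _ |- _ => inversion par; subst end.
  eexists; split; [constructor | constructor; assumption].
- match goal with par : dpar (Cabs _ _ _ _ _) _ |- _ =>
    inversion par; subst end.
  join_reducts.
  eexists; split; [constructor; eassumption | econstructor; eassumption].
Qed.

Lemma church_rosser M N : dconv M N -> exists Q, dreds M Q /\ dreds N Q.
Proof. apply (diamond_church_rosser dred_dpar dpar_dreds dpar_diamond). Qed.

Lemma trans_reflects_econv (e e' : eterm P) :
  dconv (trans e) (trans e') -> econv e e'.
Proof.
intros conv; destruct (church_rosser conv) as [Q [red red']].
destruct (invertible_dreds red (invertible_trans e)) as [q [invq redq]].
destruct (invertible_dreds red' (invertible_trans e')) as [q' [invq' redq']].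
apply invertible_inv in invq; apply invertible_inv in invq'.
replace q' with q in redq' by congruence.
apply rst_trans with q; [|apply rst_sym]; apply clos_rt_clos_rst; assumption.
Qed.

(* Only the heads on which injectivity of conversion is needed are listed. *)
Definition reduct_shape M N : Prop :=
  match M with
  | DKind => N = DKind
  | CU s => N = CU s
  | Cu s => N = Cu s
  | DPi A B => exists A' B', N = DPi A' B' /\ dreds A A' /\ dreds B B'
  | CProd s1 s2 A B =>
      exists A' B', N = CProd s1 s2 A' B' /\ dreds A A' /\ dreds B B'
  | CEl s A =>
      (exists A', N = CEl s A' /\ dreds A A') \/
      (exists s0, N = CU s0 /\ ax s0 s /\ dreds A (Cu s0))
  | _ => True
  end.

Lemma dreds_shape M N : dreds M N -> reduct_shape M N.
Proof.
assert (refl : forall X : dterm P, dreds X X) by (intros; apply rt_refl).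
assert (extend : forall X Y Z : dterm P, dreds X Y -> dred Y Z -> dreds X Z).
{ intros X Y Z redXY redYZ; eapply rt_trans; [eassumption|].
  apply rt_step, redYZ. }
revert N; apply clos_refl_trans_ind_left.
- destruct M; simpl; eauto 7.
- intros Y Z _ shape step; destruct M; simpl in *; auto;
    destruct_facts; subst; invert_dred step; eauto 7.
Qed.

Ltac join_shapes conv :=
  destruct (church_rosser conv) as [? [shape shape']];
  apply dreds_shape in shape; apply dreds_shape in shape';
  simpl in shape, shape'; destruct_facts; subst;
  repeat match goal with
  | eq : _ = _ :> dterm P |- _ => inversion eq; subst; clear eq
  end.

Lemma dconv_pi_inj A B A' B' :
  dconv (DPi A B) (DPi A' B') -> dconv A A' /\ dconv B B'.
Proof. intros conv; join_shapes conv; eauto using dreds_common_dconv. Qed.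

Lemma dconv_Prod_inj s1 s2 A B s1' s2' A' B' :
  dconv (CProd s1 s2 A B) (CProd s1' s2' A' B') -> dconv A A' /\ dconv B B'.
Proof. intros conv; join_shapes conv; eauto using dreds_common_dconv. Qed.

Lemma dconv_U_inj (s s' : sort P) : dconv (CU s) (CU s') -> s = s'.
Proof. intros conv; join_shapes conv; reflexivity. Qed.

Lemma dconv_El_U s A s0 : dconv (CEl s A) (CU s0) -> ax s0 s /\ dconv A (Cu s0).
Proof. intros conv; join_shapes conv; auto using dreds_dconv. Qed.

Lemma dconv_El_inj s A s' A' :
  functional P -> dconv (CEl s A) (CEl s' A') -> s = s' /\ dconv A A'.
Proof.
intros [ax_fun _] conv; join_shapes conv; split;
  eauto using dreds_common_dconv.
Qed.

Lemma dconv_u_dreds (s : sort P) A : dconv (Cu s) A -> dreds A (Cu s).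
Proof.
intros conv; destruct (church_rosser conv) as [Q [red red']].
apply dreds_shape in red; simpl in red; subst; assumption.
Qed.

Lemma dconv_kind_dreds A : dconv DKind A -> dreds A DKind.
Proof.
intros conv; destruct (church_rosser conv) as [Q [red red']].
apply dreds_shape in red; simpl in red; subst; assumption.
Qed.

Inductive head : Type := HeadType | HeadKind | HeadPi | HeadUniverse.

(* [CU] and [CEl] share a head because of the rule on [CEl s2 (Cu s1)]. *)
Definition type_head T : option head :=
  match T with
  | DType => Some HeadType
  | DKind => Some HeadKind
  | DPi _ _ => Some HeadPi
  | CU _ | CEl _ _ => Some HeadUniverse
  | _ => None
  end.

Lemma dreds_type_head T T' h :
  dreds T T' -> type_head T = Some h -> type_head T' = Some h.
Proof.
induction 1 as [X Y step| |]; auto; intros headX.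
destruct X; simpl in headX; inversion headX; subst; invert_dred step;
  reflexivity.
Qed.

Lemma dconv_type_head T T' h h' :
  dconv T T' -> type_head T = Some h -> type_head T' = Some h' -> h = h'.
Proof.
intros conv headT headT'; destruct (church_rosser conv) as [Q [red red']].
apply (dreds_type_head red) in headT; apply (dreds_type_head red') in headT'.
congruence.
Qed.

End Confluence.

(** * Metatheory of Dedukti typing *)

Section Typing.

Variable P : pts.
Implicit Types (M N A B T : dterm P) (G D : list (dterm P)).
Implicit Types (f : nat -> dterm P).

Lemma dtyp_wf G M T : dtyp G M T -> dwf G.
Proof. induction 1; assumption. Qed.

Lemma dsort_type : @dsort P DType.
Proof. left; reflexivity. Qed.

Lemma dsort_inst T f : dsort T -> dinst f T = T.
Proof. intros [-> | ->]; reflexivity. Qed.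

Lemma dtyp_conv_type G M A B :
  dtyp G M A -> dtyp G B DType -> dconv A B -> dtyp G M B.
Proof. intros; eapply dtyp_conv; eauto using dsort_type. Qed.

Definition inst_typed G D f : Prop :=
  forall x A, nth_error G x = Some A ->
    dtyp D (f x) (dinst f (dren (Nat.add (S x)) A)).

Definition stable_under_binders
    (K : list (dterm P) -> list (dterm P) -> (nat -> dterm P) -> Prop) : Prop :=
  forall G D f A,
    K G D f -> dwf (dinst f A :: D) -> K (A :: G) (dinst f A :: D) (dup f).

(* Used first for substitutions of variables, which gives weakening, and then,
   thanks to weakening, for arbitrary substitutions. *)
Lemma dtyp_inst_stable K :
  stable_under_binders K ->
  (forall G D f, K G D f -> dwf D -> inst_typed G D f) ->
  forall G M T, dtyp G M T ->
  forall D f, dwf D -> K G D f -> dtyp D (dinst f M) (dinst f T).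
Proof.
intros K_up K_typed G M T.
induction 1 as [|G x A _ lookup|G M A B s _ IHM sort_s _ IHB conv
  |G A B s sort_s _ IHA _ IHB|G A B M s sort_s _ IHA _ IHB _ IHM| | | |
  | |G s1 s2 s3 A B M rl123 _ IHA _ IHB _ IHM|]; intros D f wf Kf; simpl in *.
- constructor; assumption.
- apply (K_typed G); assumption.
- apply dtyp_conv with (dinst f A) s; auto using dconv_inst.
  rewrite <- (dsort_inst f sort_s); auto.
- rewrite (dsort_inst f sort_s); apply dtyp_pi; auto.
  rewrite <- (dsort_inst (dup f) sort_s).
  assert (dwf (dinst f A :: D)) by (constructor; auto); auto.
- assert (wf' : dwf (dinst f A :: D)) by (constructor; auto).
  apply dtyp_lam with s; auto.
  rewrite <- (dsort_inst (dup f) sort_s); auto.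
- rewrite dinst_dsubst0; eapply dtyp_app; eauto.
- apply dtyp_U; assumption.
- apply dtyp_El; auto.
- apply dtyp_u; auto.
- eapply dtyp_Prod; eauto.
- eapply dtyp_abs; eauto.
  rewrite <- dinst_dup_dren; auto.
- eapply dtyp_capp; eauto.
Qed.

Definition var_inst_typed G D f : Prop :=
  forall x A, nth_error G x = Some A ->
    exists y A', f x = DVar y /\ nth_error D y = Some A' /\
      dren (Nat.add (S y)) A' = dinst f (dren (Nat.add (S x)) A).

Lemma var_inst_typed_up : stable_under_binders var_inst_typed.
Proof.
intros G D f A typed _ [|x] A0 lookup; simpl in lookup.
- injection lookup as <-; exists 0, (dinst f A); repeat split.
  symmetry; apply dinst_dup_dren.
- destruct (typed _ _ lookup) as [y [A' [fx [lookup' eqA]]]].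
  exists (S y), A'; repeat split; simpl;
    [rewrite fx; reflexivity | assumption|].
  rewrite (dren_add_S (S y)), eqA, (dren_add_S (S x)), dinst_dup_dren.
  reflexivity.
Qed.

Lemma dtyp_weaken G M T A :
  dtyp G M T -> dtyp G A DType -> dtyp (A :: G) (dren S M) (dren S T).
Proof.
intros typM typA; rewrite !dren_dinst_var.
apply (dtyp_inst_stable var_inst_typed_up) with (2 := typM).
- intros G' D f typed wf x B lookup.
  destruct (typed _ _ lookup) as [y [B' [-> [lookup' <-]]]].
  apply dtyp_var; assumption.
- constructor; assumption.
- intros x B lookup; exists (S x), B; repeat split; [assumption|].
  rewrite (dren_add_S (S x)); apply dren_dinst_var.
Qed.

Lemma dtyp_lookup G : dwf G -> forall x A, nth_error G x = Some A ->
  dtyp G (dren (Nat.add (S x)) A) DType.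
Proof.
induction G as [|B G IH]; intros wf [|x] A lookup; try discriminate;
  inversion wf; subst.
- injection lookup as <-; apply (dtyp_weaken (T := DType)); assumption.
- rewrite dren_add_S; apply (dtyp_weaken (T := DType)); [|assumption].
  apply IH; [eapply dtyp_wf; eassumption | assumption].
Qed.

Lemma inst_typed_up : stable_under_binders inst_typed.
Proof.
intros G D f A typed wf [|x] A0 lookup; simpl in *.
- injection lookup as <-; change (Nat.add 1) with S; rewrite dinst_dup_dren.
  apply dtyp_var with (x := 0); [assumption | reflexivity].
- rewrite (dren_add_S (S x)), dinst_dup_dren.
  inversion wf; subst; apply dtyp_weaken; auto.
Qed.

Lemma dtyp_inst G M T : dtyp G M T ->
  forall D f, dwf D -> inst_typed G D f -> dtyp D (dinst f M) (dinst f T).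
Proof. apply (dtyp_inst_stable inst_typed_up); auto. Qed.

Lemma dtyp_subst G A M T N :
  dtyp (A :: G) M T -> dtyp G N A -> dtyp G (dsubst 0 N M) (dsubst 0 N T).
Proof.
intros typM typN; rewrite !dsubst0E.
apply (dtyp_inst typM); [eapply dtyp_wf; eassumption|].
intros [|x] B lookup; simpl in *; rewrite dinst_dren; simpl.
- injection lookup as <-; rewrite dinst_var; assumption.
- rewrite <- dren_dinst_var; apply dtyp_var; [eapply dtyp_wf|]; eassumption.
Qed.

Lemma dtyp_ctx_conv G A A' M T :
  dtyp (A :: G) M T -> dtyp G A' DType -> dconv A A' -> dtyp (A' :: G) M T.
Proof.
intros typM typA' conv.
assert (typA : dtyp G A DType) by
  (assert (wf := dtyp_wf typM); inversion wf; assumption).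
rewrite <- (dinst_var M), <- (dinst_var T).
apply (dtyp_inst typM); [constructor; assumption|].
intros [|x] B lookup; rewrite dinst_var.
- injection lookup as <-.
  apply dtyp_conv_type with (dren (Nat.add 1) A').
  + constructor; [constructor; assumption | reflexivity].
  + apply (dtyp_weaken (T := DType)); assumption.
  + apply dconv_ren, dconv_sym; assumption.
- apply dtyp_var; [constructor|]; assumption.
Qed.

Definition generation G M T : Prop :=
  match M with
  | DVar x =>
      exists A, nth_error G x = Some A /\ dconv (dren (Nat.add (S x)) A) T
  | DType => dconv DKind T
  | DKind => False
  | DApp M N =>
      exists A B, dtyp G M (DPi A B) /\ dtyp G N A /\ dconv (dsubst 0 N B) T
  | DLam A M =>
      exists B s, dsort s /\ dtyp G A DType /\ dtyp (A :: G) B s /\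
                  dtyp (A :: G) M B /\ dconv (DPi A B) T
  | DPi A B =>
      exists s, dsort s /\ dtyp G A DType /\ dtyp (A :: G) B s /\ dconv s T
  | CU _ => dconv DType T
  | CEl s A => dtyp G A (CU s) /\ dconv DType T
  | Cu s => exists s', ax s s' /\ dconv (CU s') T
  | CProd s1 s2 A B =>
      exists s3, rl s1 s2 s3 /\ dtyp G A (CU s1) /\
        dtyp G B (darrow (CEl s1 A) (CU s2)) /\ dconv (CU s3) T
  | Cabs s1 s2 A B M =>
      exists s3, rl s1 s2 s3 /\ dtyp G A (CU s1) /\
        dtyp G B (darrow (CEl s1 A) (CU s2)) /\
        dtyp G M (DPi (CEl s1 A) (CEl s2 (DApp (dren S B) (DVar 0)))) /\
        dconv (CEl s3 (CProd s1 s2 A B)) T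
  | Capp s1 s2 A B M N =>
      exists s3, rl s1 s2 s3 /\ dtyp G A (CU s1) /\
        dtyp G B (darrow (CEl s1 A) (CU s2)) /\
        dtyp G M (CEl s3 (CProd s1 s2 A B)) /\ dtyp G N (CEl s1 A) /\
        dconv (CEl s2 (DApp B N)) T
  end.

Lemma dtyp_generation G M T : dtyp G M T -> generation G M T.
Proof.
induction 1 as [| |G M A B s _ IHM _ _ _ conv| | | | | | | | |];
  simpl; eauto 10 using dconv_refl.
destruct M; simpl in *; destruct_facts; eauto 12 using dconv_trans.
Qed.

Lemma dtyp_u_inv G (s s' : sort P) : dtyp G (Cu s) (CU s') -> ax s s'.
Proof.
intros typ; destruct (dtyp_generation typ) as [s0 [ax0 conv]].
apply dconv_U_inj in conv; subst; assumption.
Qed.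

Lemma dtyp_darrow G A s1 s2 :
  dtyp G A (CU s1) -> dtyp G (darrow (CEl s1 A) (CU s2)) DType.
Proof.
intros typA; assert (typE : dtyp G (CEl s1 A) DType) by (apply dtyp_El, typA).
apply dtyp_pi; [apply dsort_type | assumption|].
apply dtyp_U; constructor; assumption.
Qed.

Lemma dtyp_apply_var G A B s1 s2 :
  dtyp G A (CU s1) -> dtyp G B (darrow (CEl s1 A) (CU s2)) ->
  dtyp (CEl s1 A :: G) (CEl s2 (DApp (dren S B) (DVar 0))) DType.
Proof.
intros typA typB.
assert (typE : dtyp G (CEl s1 A) DType) by (apply dtyp_El, typA).
apply dtyp_El, (dtyp_app (A := dren S (CEl s1 A)) (B := CU s2)).
- apply (dtyp_weaken typB typE).
- apply (dtyp_var (x := 0)); [constructor; assumption | reflexivity].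
Qed.

Lemma dtyp_pi_apply_var G A B s1 s2 :
  dtyp G A (CU s1) -> dtyp G B (darrow (CEl s1 A) (CU s2)) ->
  dtyp G (DPi (CEl s1 A) (CEl s2 (DApp (dren S B) (DVar 0)))) DType.
Proof.
intros typA typB; apply dtyp_pi; [apply dsort_type | apply dtyp_El, typA|].
apply dtyp_apply_var; assumption.
Qed.

Lemma dtyp_El_Prod G s1 s2 s3 A B :
  rl s1 s2 s3 -> dtyp G A (CU s1) -> dtyp G B (darrow (CEl s1 A) (CU s2)) ->
  dtyp G (CEl s3 (CProd s1 s2 A B)) DType.
Proof. intros; apply dtyp_El; eapply dtyp_Prod; eassumption. Qed.

Lemma dtyp_El_app G A B N s1 s2 :
  dtyp G B (darrow (CEl s1 A) (CU s2)) -> dtyp G N (CEl s1 A) ->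
  dtyp G (CEl s2 (DApp B N)) DType.
Proof. intros typB typN; apply dtyp_El, (dtyp_app typB typN). Qed.

Lemma dtyp_subst_sort G A B N s :
  dsort s -> dtyp (A :: G) B s -> dtyp G N A -> dtyp G (dsubst 0 N B) s.
Proof.
intros sort_s typB typN.
rewrite <- (dsort_inst (scons N (@DVar P)) sort_s), <- dsubst0E.
eapply dtyp_subst; eassumption.
Qed.

Lemma dtyp_pi_inv G A B s0 : dtyp G (DPi A B) s0 ->
  exists s, dsort s /\ dtyp (A :: G) B s.
Proof.
intros typ; apply dtyp_generation in typ; simpl in typ; destruct_facts; eauto.
Qed.

Lemma dtyp_type_correct G M T :
  dtyp G M T -> T = DKind \/ exists s, dsort s /\ dtyp G T s.
Proof.
assert (sort_kind : @dsort P DKind) by (right; reflexivity).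
assert (of_type : forall G' T', dtyp G' T' DType ->
  T' = DKind \/ exists s, dsort s /\ dtyp G' T' s) by eauto using dsort_type.
assert (type_kind : forall G', dwf G' ->
  @DType P = DKind \/ exists s, dsort s /\ dtyp G' DType s)
  by eauto using dtyp_type.
induction 1 as [| | |G A B s [-> | ->]|G A B M s sort_s typA _ typB _ _ _
  |G A B M N _ IHM typN _| | | | | |];
  eauto using dtyp_lookup, dtyp_wf, dtyp_U, dtyp_El_Prod, dtyp_El_app.
- right; exists s; split; [assumption | apply dtyp_pi; assumption].
- destruct IHM as [e|[s [_ typPi]]]; [discriminate|].
  destruct (dtyp_pi_inv typPi) as [s' [sort_s' typB]].
  right; exists s'; split; [assumption | eapply dtyp_subst_sort; eassumption].
Qed.

Lemma dtyp_pi_codomain G A B M :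
  dtyp G M (DPi A B) -> exists s, dsort s /\ dtyp (A :: G) B s.
Proof.
intros typM; destruct (dtyp_type_correct typM) as [e|[s [_ typPi]]];
  [discriminate | eapply dtyp_pi_inv, typPi].
Qed.

Lemma dtyp_unique (hP : functional P) G M T T' :
  dtyp G M T -> dtyp G M T' -> dconv T T'.
Proof.
destruct hP as [ax_fun rl_fun]; intros typ; revert T'.
induction typ as [G wf|G x A wf lookup|G M A B s _ IHM _ _ _ conv
  |G A B s sort_s _ _ _ IHB|G A B M s _ _ _ _ _ _ IHM|G A B M N _ IHM _ _
  |G s wf|G s A _ _|G s1 s2 ax12 wf|G s1 s2 s3 A B rl123 _ _ _ _
  |G s1 s2 s3 A B M rl123|]; intros T' typ';
  assert (gen := dtyp_generation typ'); simpl in gen; auto.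
- destruct gen as [A' [lookup' conv']].
  replace A with A' by congruence; exact conv'.
- eapply dconv_trans; [apply dconv_sym; eassumption | auto].
- destruct gen as [s' [_ [_ [typB conv']]]].
  eapply dconv_trans; [apply IHB, typB | exact conv'].
- destruct gen as [B' [s' [_ [_ [_ [typM conv']]]]]].
  eapply dconv_trans; [|exact conv'].
  apply dconv_pi; [apply dconv_refl | apply IHM, typM].
- destruct gen as [A' [B' [typM [_ conv']]]].
  eapply dconv_trans; [|exact conv'].
  apply dconv_subst; [|apply dconv_refl].
  apply IHM, dconv_pi_inj in typM; apply typM.
- apply gen.
- destruct gen as [s' [ax' conv']].
  rewrite (ax_fun _ _ _ ax12 ax'); exact conv'.
- destruct gen as [s' [rl' [_ [_ conv']]]].
  rewrite (rl_fun _ _ _ _ rl123 rl'); exact conv'.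
- destruct gen as [s' [rl' [_ [_ [_ conv']]]]].
  rewrite (rl_fun _ _ _ _ rl123 rl'); exact conv'.
- destruct gen as [s' [_ [_ [_ [_ [_ conv']]]]]]; exact conv'.
Qed.

End Typing.

(** * Subject reduction *)

Section SubjectReduction.

Variable P : pts.
Hypothesis hP : functional P.
Implicit Types (M N A B T : dterm P) (G : list (dterm P)).

Lemma dtyp_family_conv G A A' B s1 s2 :
  dtyp G B (darrow (CEl s1 A) (CU s2)) -> dtyp G A' (CU s1) -> dconv A A' ->
  dtyp G B (darrow (CEl s1 A') (CU s2)).
Proof.
intros typB typA' conv.
apply (dtyp_conv_type typB); [apply dtyp_darrow, typA'|].
apply dconv_pi; [apply dconv_El, conv | apply dconv_refl].
Qed.

Lemma dtyp_pi_conv G A A' B s :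
  dsort s -> dtyp G A' DType -> dtyp (A :: G) B s -> dconv A A' ->
  dtyp G (DPi A' B) s.
Proof. intros; apply dtyp_pi; auto; eapply dtyp_ctx_conv; eassumption. Qed.

Lemma dtyp_lam_conv G A A' B M s :
  dsort s -> dtyp G A DType -> dtyp G A' DType ->
  dtyp (A :: G) B s -> dtyp (A :: G) M B -> dconv A A' ->
  dtyp G (DLam A' M) (DPi A B).
Proof.
intros sort_s typA typA' typB typM conv.
apply dtyp_conv with (DPi A' B) s; auto.
- apply dtyp_lam with s; auto; eapply dtyp_ctx_conv; eassumption.
- apply dtyp_pi; assumption.
- apply dconv_pi; [apply dconv_sym, conv | apply dconv_refl].
Qed.

Lemma dtyp_app_conv G A B M N N' :
  dtyp G M (DPi A B) -> dtyp G N A -> dtyp G N' A -> dconv N N' ->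
  dtyp G (DApp M N') (dsubst 0 N B).
Proof.
intros typM typN typN' conv.
destruct (dtyp_pi_codomain typM) as [s [sort_s typB]].
apply dtyp_conv with (dsubst 0 N' B) s; auto.
- eapply dtyp_app; eassumption.
- eapply dtyp_subst_sort; eassumption.
- apply dconv_subst; [apply dconv_refl | apply dconv_sym, conv].
Qed.

Lemma dtyp_Prod_conv G s1 s2 s3 A A' B :
  rl s1 s2 s3 -> dtyp G A' (CU s1) -> dtyp G B (darrow (CEl s1 A) (CU s2)) ->
  dconv A A' -> dtyp G (CProd s1 s2 A' B) (CU s3).
Proof. intros; eapply dtyp_Prod; eauto using dtyp_family_conv. Qed.

Lemma dtyp_abs_conv G s1 s2 s3 A A' B B' M :
  rl s1 s2 s3 ->
  dtyp G A (CU s1) -> dtyp G A' (CU s1) ->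
  dtyp G B (darrow (CEl s1 A) (CU s2)) ->
  dtyp G B' (darrow (CEl s1 A) (CU s2)) ->
  dtyp G M (DPi (CEl s1 A) (CEl s2 (DApp (dren S B) (DVar 0)))) ->
  dconv A A' -> dconv B B' ->
  dtyp G (Cabs s1 s2 A' B' M) (CEl s3 (CProd s1 s2 A B)).
Proof.
intros rl123 typA typA' typB typB' typM convA convB.
apply dtyp_conv_type with (CEl s3 (CProd s1 s2 A' B')).
- eapply dtyp_abs; eauto using dtyp_family_conv.
  apply (dtyp_conv_type typM);
    [eauto using dtyp_pi_apply_var, dtyp_family_conv|].
  apply dconv_pi; apply dconv_El; [assumption|].
  apply dconv_app; [apply dconv_ren, convB | apply dconv_refl].
- eapply dtyp_El_Prod; eassumption.
- apply dconv_El, dconv_Prod; apply dconv_sym; assumption.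
Qed.

Lemma dtyp_capp_conv G s1 s2 s3 A A' B B' M N N' :
  rl s1 s2 s3 ->
  dtyp G A (CU s1) -> dtyp G A' (CU s1) ->
  dtyp G B (darrow (CEl s1 A) (CU s2)) ->
  dtyp G B' (darrow (CEl s1 A) (CU s2)) ->
  dtyp G M (CEl s3 (CProd s1 s2 A B)) ->
  dtyp G N (CEl s1 A) -> dtyp G N' (CEl s1 A) ->
  dconv A A' -> dconv B B' -> dconv N N' ->
  dtyp G (Capp s1 s2 A' B' M N') (CEl s2 (DApp B N)).
Proof.
intros rl123 typA typA' typB typB' typM typN typN' convA convB convN.
apply dtyp_conv_type with (CEl s2 (DApp B' N')).
- eapply dtyp_capp; eauto using dtyp_family_conv.
  + apply (dtyp_conv_type typM); [eauto using dtyp_El_Prod, dtyp_family_conv|].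
    apply dconv_El, dconv_Prod; assumption.
  + apply (dtyp_conv_type typN');
      [apply dtyp_El, typA' | apply dconv_El, convA].
- eapply dtyp_El_app; eassumption.
- apply dconv_El, dconv_app; apply dconv_sym; assumption.
Qed.

Lemma subject_reduction_beta G A A' B M N :
  dtyp G (DLam A M) (DPi A' B) -> dtyp G N A' ->
  dtyp G (dsubst 0 N M) (dsubst 0 N B).
Proof.
intros typLam typN; destruct (dtyp_pi_codomain typLam) as [s [sort_s typB]].
destruct (dtyp_generation typLam)
  as [B0 [s0 [sort_s0 [typA [typB0 [typM conv]]]]]].
apply dconv_pi_inj in conv; destruct conv as [convA convB].
apply dtyp_conv with (dsubst 0 N B0) s; auto.
- apply (dtyp_subst typM), (dtyp_conv_type typN); auto using dconv_sym.
- eapply dtyp_subst_sort; eassumption.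
- apply dconv_subst; [assumption | apply dconv_refl].
Qed.

Lemma subject_reduction_app_abs G s1 s2 s3 A A' B B' M N :
  dtyp G (Cabs s1 s2 A' B' M) (CEl s3 (CProd s1 s2 A B)) ->
  dtyp G B (darrow (CEl s1 A) (CU s2)) -> dtyp G N (CEl s1 A) ->
  dtyp G (DApp M N) (CEl s2 (DApp B N)).
Proof.
intros typAbs typB typN.
destruct (dtyp_generation typAbs) as [s4 [_ [typA' [typB' [typM conv]]]]].
apply (dconv_El_inj hP) in conv; destruct conv as [_ conv].
apply dconv_Prod_inj in conv; destruct conv as [convA convB].
assert (typN' : dtyp G N (CEl s1 A')).
{ apply (dtyp_conv_type typN); [apply dtyp_El, typA'|].
  apply dconv_El, dconv_sym, convA. }
apply dtyp_conv_type with (1 := dtyp_app typM typN').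
- eapply dtyp_El_app; eassumption.
- change (dconv (CEl s2 (DApp (dsubst 0 N (dren S B')) N)) (CEl s2 (DApp B N))).
  rewrite dsubst0_dren.
  apply dconv_El, dconv_app; [assumption | apply dconv_refl].
Qed.

Lemma subject_reduction_step G M T :
  dtyp G M T -> forall M', dred M M' -> dtyp G M' T.
Proof.
induction 1; intros M' step; try (invert_dred step; fail).
- eapply dtyp_conv; eauto.
- invert_dred step; [eapply dtyp_pi_conv | apply dtyp_pi];
    eauto using dred_dconv.
- invert_dred step; [eapply dtyp_lam_conv | eapply dtyp_lam];
    eauto using dred_dconv.
- invert_dred step; [eapply subject_reduction_beta | eapply dtyp_app
    | eapply dtyp_app_conv]; eauto using dred_dconv.
- invert_dred step; [apply dtyp_U; eapply dtyp_wf; eassumption|].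
  apply dtyp_El; auto.
- invert_dred step; eapply dtyp_Prod_conv; eauto using dred_dconv, dconv_refl.
- invert_dred step; eapply dtyp_abs_conv; eauto using dred_dconv, dconv_refl.
- invert_dred step; [eapply subject_reduction_app_abs; eassumption|..];
    eapply dtyp_capp_conv; eauto using dred_dconv, dconv_refl.
Qed.

Lemma subject_reduction G M M' T : dtyp G M T -> dreds M M' -> dtyp G M' T.
Proof.
intros typ red; revert typ; induction red; eauto using subject_reduction_step.
Qed.

Lemma dconv_unique_U G M M' s s' :
  dtyp G M (CU s) -> dtyp G M' (CU s') -> dconv M M' -> s = s'.
Proof.
intros typ typ' conv; destruct (church_rosser conv) as [N [red red']].
apply dconv_U_inj, (dtyp_unique hP (M := N) (G := G));
  eapply subject_reduction; eassumption.
Qed.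

End SubjectReduction.

(** * The translation preserves typing *)

Section Soundness.

Variable P : pts.
Hypothesis hP : functional P.
Implicit Types (M N A B : eterm P) (G : list (eterm P)) (D : list (dterm P)).

(* For a sort [s] that is not a top sort, both [CU s] and [CEl s' (Cu s)] are
   accepted: which one is obtained depends on the typing derivation. *)
Definition translation_typed D M A : Prop :=
  (exists s, dtyp D (trans A) (CU s) /\ dtyp D (trans M) (CEl s (trans A))) \/
  (exists s, A = ESort s /\ dtyp D (trans M) (CU s)).

Lemma translation_typed_U D M s :
  translation_typed D M (ESort s) -> dtyp D (trans M) (CU s).
Proof.
intros [[s' [typs typM]]|[s' [eqs typM]]].
- apply (dtyp_conv_type typM).
  + apply dtyp_U; eapply dtyp_wf; eassumption.
  + eapply dconv_El_u, dtyp_u_inv, typs.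
- injection eqs as ->; assumption.
Qed.

Lemma translation_typed_conv D M A B s :
  translation_typed D M A -> dtyp D (trans B) (CU s) ->
  dconv (trans A) (trans B) -> dtyp D (trans M) (CEl s (trans B)).
Proof.
intros typM typB conv.
assert (typE : dtyp D (CEl s (trans B)) DType) by (apply dtyp_El, typB).
destruct typM as [[s' [typA typM]]|[s' [-> typM]]];
  apply (dtyp_conv_type typM typE).
- rewrite (dconv_unique_U hP typA typB conv); apply dconv_El, conv.
- apply dconv_trans with (CEl s (Cu s')); [|apply dconv_El, conv].
  apply dconv_sym, dconv_El_u, (dtyp_u_inv (G := D)).
  apply (subject_reduction hP typB), dconv_u_dreds, conv.
Qed.

Lemma translation_typed_El D M A s :
  translation_typed D M A -> dtyp D (trans A) (CU s) ->
  dtyp D (trans M) (CEl s (trans A)).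
Proof. intros; eapply translation_typed_conv; eauto using dconv_refl. Qed.

Lemma trans_ctx_lookup G D x A :
  trans_ctx G D -> nth_error G x = Some A ->
  exists s, nth_error D x = Some (CEl s (trans A)).
Proof.
intros ctx; revert x; induction ctx as [|G D A' s _ IH _]; intros [|x] lookup;
  try discriminate; simpl in *; auto.
injection lookup as ->; eauto.
Qed.

Lemma dtyp_trans_var G D x A :
  trans_ctx G D -> dwf D -> nth_error G x = Some A ->
  translation_typed D (EVar x) (eren (Nat.add (S x)) A).
Proof.
intros ctx wf lookup; destruct (trans_ctx_lookup ctx lookup) as [s lookup'].
left; exists s; rewrite trans_ren; split.
- apply (dtyp_generation (dtyp_lookup wf lookup')).
- apply (dtyp_var (A := CEl s (trans A))); assumption.
Qed.

Lemma dtyp_trans_family D A B s1 s2 :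
  dtyp D (trans A) (CU s1) -> dtyp (CEl s1 (trans A) :: D) (trans B) (CU s2) ->
  dtyp D (DLam (CEl s1 (trans A)) (trans B))
    (darrow (CEl s1 (trans A)) (CU s2)).
Proof.
intros typA typB; apply dtyp_lam with DType; auto using dsort_type, dtyp_El.
apply dtyp_U; eapply dtyp_wf; eassumption.
Qed.

Lemma dtyp_trans_pi D A B s1 s2 s3 :
  rl s1 s2 s3 ->
  dtyp D (trans A) (CU s1) -> dtyp (CEl s1 (trans A) :: D) (trans B) (CU s2) ->
  dtyp D (trans (EPi s1 s2 A B)) (CU s3).
Proof. intros; eapply dtyp_Prod; eauto using dtyp_trans_family. Qed.

Lemma dtyp_trans_lam D A B M s1 s2 s3 :
  rl s1 s2 s3 ->
  dtyp D (trans A) (CU s1) -> dtyp (CEl s1 (trans A) :: D) (trans B) (CU s2) ->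
  dtyp (CEl s1 (trans A) :: D) (trans M) (CEl s2 (trans B)) ->
  dtyp D (trans (ELam s1 s2 A B M)) (CEl s3 (trans (EPi s1 s2 A B))).
Proof.
intros rl123 typA typB typM; assert (typF := dtyp_trans_family typA typB).
eapply dtyp_abs; eauto.
eapply dtyp_lam; eauto using dsort_type, dtyp_apply_var, dtyp_El.
apply (dtyp_conv_type typM); [apply dtyp_apply_var; assumption|].
apply dconv_El, dconv_sym, dconv_apply_var.
Qed.

Lemma dtyp_trans_app D A B M N s1 s2 s3 :
  rl s1 s2 s3 ->
  dtyp D (trans A) (CU s1) -> dtyp (CEl s1 (trans A) :: D) (trans B) (CU s2) ->
  dtyp D (trans M) (CEl s3 (trans (EPi s1 s2 A B))) ->
  dtyp D (trans N) (CEl s1 (trans A)) ->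
  dtyp D (trans (esubst 0 N B)) (CU s2) /\
  dtyp D (trans (EApp s1 s2 A B M N)) (CEl s2 (trans (esubst 0 N B))).
Proof.
intros rl123 typA typB typM typN; assert (typF := dtyp_trans_family typA typB).
rewrite <- trans_subst.
assert (typBN : dtyp D (dsubst 0 (trans N) (trans B)) (CU s2)) by
  (apply (dtyp_subst typB typN)).
split; [assumption|].
eapply dtyp_conv_type; [eapply dtyp_capp; eassumption | apply dtyp_El, typBN|].
apply dconv_El, dconv_beta.
Qed.

Lemma etyp_translation_typed G M A : etyp G M A ->
  forall D, trans_ctx G D -> dwf D -> translation_typed D M A.
Proof.
assert (extend : forall G D A s, trans_ctx G D -> etyp G A (ESort s) ->
  dtyp D (trans A) (CU s) ->
  trans_ctx (A :: G) (CEl s (trans A) :: D) /\ dwf (CEl s (trans A) :: D)).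
{ intros; split; constructor; auto using dtyp_El. }
induction 1 as [G x A _ lookup|G s1 s2 _ ax12|G M A B s typM IHM typB IHB conv
  |G s1 s2 s3 A B rl123 typA IHA typB IHB
  |G s1 s2 s3 A B M rl123 typA IHA typB IHB typM IHM
  |G s1 s2 s3 A B M N rl123 typA IHA typB IHB typM IHM typN IHN];
  intros D ctx wf;
  try (assert (typA' := translation_typed_U (IHA D ctx wf));
    destruct (extend _ _ _ _ ctx typA typA') as [ctx' wf'];
    assert (typB' := translation_typed_U (IHB _ ctx' wf'))).
- eapply dtyp_trans_var; eassumption.
- right; exists s2; split; [reflexivity | apply dtyp_u; assumption].
- assert (typB' := translation_typed_U (IHB D ctx wf)).
  left; exists s; split; [assumption|].
  eapply translation_typed_conv; eauto using trans_econv.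
- right; exists s3; split; [reflexivity | eapply dtyp_trans_pi; eassumption].
- left; exists s3; split; [eapply dtyp_trans_pi; eassumption|].
  eapply dtyp_trans_lam; eauto using translation_typed_El.
- left; exists s2; eapply dtyp_trans_app;
    eauto using translation_typed_El, dtyp_trans_pi.
Qed.

Lemma trans_ctx_dwf G D : trans_ctx G D -> dwf D.
Proof.
induction 1 as [|G D A s ctx wf typA]; constructor.
apply dtyp_El, translation_typed_U, (etyp_translation_typed typA ctx wf).
Qed.

Lemma trans_sound G D M A T :
  trans_ctx G D -> trans_type G A T -> etyp G M A -> dtyp D (trans M) T.
Proof.
intros ctx type typM; assert (wf := trans_ctx_dwf ctx).
assert (typM' := etyp_translation_typed typM ctx wf).
destruct type as [s _|A s typA]; [apply translation_typed_U, typM'|].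
apply (translation_typed_El typM'), translation_typed_U.
apply (etyp_translation_typed typA ctx wf).
Qed.

End Soundness.

(** * Beta-normal terms *)

Section BetaNormal.

Variable P : pts.
Implicit Types (M N : dterm P).

Definition is_lam M : bool := match M with DLam _ _ => true | _ => false end.

Fixpoint nf M : Prop :=
  match M with
  | DVar _ | DType | DKind | CU _ | Cu _ => True
  | DApp M N => is_lam M = false /\ nf M /\ nf N
  | DLam M N | DPi M N | CProd _ _ M N => nf M /\ nf N
  | CEl _ M => nf M
  | Cabs _ _ A B M => nf A /\ nf B /\ nf M
  | Capp _ _ A B M N => nf A /\ nf B /\ nf M /\ nf N
  end.

Lemma nf_beta_normal M : nf M -> beta_normal M.
Proof.
intros nfM N step; revert nfM.
induction step as [M N []| | | | | | | | | | | | | | | |]; simpl;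
  intuition discriminate.
Qed.

Lemma beta_normal_nf M : beta_normal M -> nf M.
Proof.
induction M; simpl; intros normal; repeat split;
  try match goal with
  | IH : _ -> nf ?N |- nf ?N =>
      apply IH; intros N' step; eapply normal; constructor; exact step
  end.
destruct M1; try reflexivity.
exfalso; eapply normal; constructor; constructor.
Qed.

Lemma is_lam_ren M r : is_lam (dren r M) = is_lam M.
Proof. destruct M; reflexivity. Qed.

Lemma nf_ren M : forall r, nf M -> nf (dren r M).
Proof. induction M; simpl; intros; rewrite ?is_lam_ren; intuition auto. Qed.

Lemma nf_trans (e : eterm P) : nf (trans e).
Proof. induction e; simpl; auto. Qed.

End BetaNormal.

(** * Inverting beta-normal terms *)

Section Conservativity.

Variable P : pts.
Hypothesis hP : functional P.
Implicit Types (M N U V T : dterm P) (G : list (eterm P)) (D : list (dterm P)).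
Implicit Types (A B C a b e : eterm P).

Lemma etyp_wf G e A : etyp G e A -> ewf G.
Proof. induction 1; assumption. Qed.

(* [trans_ctx] up to conversion: the domain of a normal term of product type is
   only convertible to the translation of the domain of the product. *)
Inductive conv_ctx : list (eterm P) -> list (dterm P) -> Prop :=
| conv_ctx_nil : conv_ctx [] []
| conv_ctx_cons G D A T s :
    conv_ctx G D -> etyp G A (ESort s) -> dconv T (CEl s (trans A)) ->
    conv_ctx (A :: G) (T :: D).

Lemma trans_ctx_conv_ctx G D : trans_ctx G D -> conv_ctx G D.
Proof. induction 1; econstructor; eauto using dconv_refl. Qed.

Lemma conv_ctx_ewf G D : conv_ctx G D -> ewf G.
Proof. destruct 1; econstructor; eassumption. Qed.

Lemma conv_ctx_lookup G D x T : conv_ctx G D -> nth_error D x = Some T ->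
  exists A s, nth_error G x = Some A /\
    dconv (dren (Nat.add (S x)) T) (CEl s (trans (eren (Nat.add (S x)) A))).
Proof.
intros ctx lookup.
enough (found : exists A s,
  nth_error G x = Some A /\ dconv T (CEl s (trans A))).
{ destruct found as [A [s [lookupA conv]]]; exists A, s; split; [assumption|].
  rewrite trans_ren; apply (dconv_ren (Nat.add (S x)) conv). }
revert x lookup; induction ctx; intros [|x] lookup; try discriminate;
  simpl in *; eauto.
injection lookup as <-; eauto.
Qed.

Definition represents_type G A T : Prop :=
  (exists s, A = ESort s /\ dconv T (CU s)) \/
  (exists s, etyp G A (ESort s) /\ dconv T (CEl s (trans A))).

Lemma represents_U G (s : sort P) : represents_type G (ESort s) (CU s).
Proof. left; eauto using dconv_refl. Qed.

Lemma represents_El G A M s :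
  etyp G A (ESort s) -> dconv M (trans A) -> represents_type G A (CEl s M).
Proof. intros typA conv; right; exists s; split; auto using dconv_El. Qed.

Lemma trans_type_represents G A T : trans_type G A T -> represents_type G A T.
Proof. intros []; auto using represents_U, represents_El, dconv_refl. Qed.

Lemma represents_conv G A T U :
  represents_type G A T -> dconv U T -> represents_type G A U.
Proof.
intros [[s [eqA convT]]|[s [typA convT]]] convU; [left|right];
  eauto using dconv_trans.
Qed.

Lemma represents_type_head G A T U h :
  represents_type G A T -> dconv U T -> type_head U = Some h ->
  h = HeadUniverse.
Proof.
intros [[s [_ convT]]|[s [_ convT]]] convU headU;
  exact (dconv_type_head (dconv_trans convU convT) headU eq_refl).
Qed.

Lemma etyp_represents_U G e A T s :
  etyp G e (ESort s) -> dconv (CU s) T -> represents_type G A T -> etyp G e A.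
Proof.
intros typ conv [[s' [-> convT]]|[s' [typA convT]]];
  assert (conv' := dconv_trans conv convT).
- apply dconv_U_inj in conv'; subst; assumption.
- apply dconv_sym, dconv_El_U in conv'; destruct conv' as [_ conv'].
  eapply etyp_conv; [eassumption..|].
  apply trans_reflects_econv, dconv_sym, conv'.
Qed.

Lemma etyp_represents_El G e A A' T s :
  etyp G e A' -> dconv (CEl s (trans A')) T -> represents_type G A T ->
  etyp G e A.
Proof.
intros typ conv [[s' [-> convT]]|[s' [typA convT]]];
  assert (conv' := dconv_trans conv convT).
- apply dconv_El_U in conv'; destruct conv' as [ax' conv'].
  eapply etyp_conv; [eassumption | apply etyp_sort; eauto using etyp_wf|].
  apply trans_reflects_econv, conv'.
- apply (dconv_El_inj hP) in conv'; destruct conv' as [_ conv'].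
  eapply etyp_conv; [eassumption..|].
  apply trans_reflects_econv, conv'.
Qed.

Lemma nf_pi_lam G D M U V :
  conv_ctx G D -> nf M -> dtyp D M (DPi U V) -> exists T N, M = DLam T N.
Proof.
intros ctx; revert U V; induction M; intros U V nfM typM;
  apply dtyp_generation in typM; simpl in typM; destruct_facts; eauto;
  try contradiction;
  try match goal with
  | sort_s : dsort _ |- _ => destruct sort_s as [-> | ->]
  end;
  try match goal with
  | conv : dconv _ (DPi _ _) |- _ =>
      discriminate (dconv_type_head conv eq_refl eq_refl)
  end.
- match goal with lookup : nth_error D x = Some _ |- _ =>
    destruct (conv_ctx_lookup ctx lookup) as [A' [s [_ conv']]] end.
  match goal with conv : dconv _ (DPi _ _) |- _ =>
    discriminate (dconv_type_head (dconv_trans (dconv_sym conv') conv)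
      eq_refl eq_refl) end.
- destruct nfM as [not_lam [nfM1 _]].
  edestruct IHM1 as [T [N ->]]; [assumption | eassumption | discriminate].
Qed.

Lemma nf_app_untypable G D M N T :
  conv_ctx G D -> nf (DApp M N) -> ~ dtyp D (DApp M N) T.
Proof.
intros ctx [not_lam [nfM _]] typ.
destruct (dtyp_generation typ) as [U [V [typM _]]].
destruct (nf_pi_lam ctx nfM typM) as [T' [N' ->]]; discriminate.
Qed.

Definition object_form M : bool :=
  match M with
  | DType | DKind | DLam _ _ | DPi _ _ | CU _ | CEl _ _ => false
  | _ => true
  end.

Lemma object_form_of_type G D A T M :
  dtyp D M T -> represents_type G A T -> object_form M = true.
Proof.
intros typ repr; apply dtyp_generation in typ.
destruct M; simpl in *; auto; exfalso; destruct_facts; try contradiction;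
  try match goal with sort_s : dsort _ |- _ => destruct sort_s as [-> | ->] end;
  match goal with conv : dconv _ T |- _ =>
    discriminate (represents_type_head repr conv eq_refl) end.
Qed.

Record typed_inverse G M A e : Prop := {
  inverse_invertible : invertible M e;
  inverse_typed : etyp G e A;
  inverse_H_equiv : H_equiv (trans e) M }.

Lemma inverse_dconv G M A e : typed_inverse G M A e -> dconv M (trans e).
Proof. intros invM; apply dconv_sym, H_equiv_dconv, invM. Qed.

Definition object_invertible M : Prop :=
  forall G D A T, conv_ctx G D -> dtyp D M T -> represents_type G A T ->
  exists e, typed_inverse G M A e.

Definition family_invertible M : Prop :=
  forall G D a s B U V, conv_ctx G D -> dtyp D M (DPi U V) ->
  etyp G a (ESort s) -> dconv U (CEl s (trans a)) ->
  represents_type (a :: G) B V ->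
  exists T N b, M = DLam T N /\ typed_inverse (a :: G) N B b /\
    H_equiv (DLam (CEl s (trans a)) (trans b)) M.

Lemma family_invertible_lam T N :
  object_invertible N -> family_invertible (DLam T N).
Proof.
intros objN G D a s B U V ctx typLam typa convU reprB.
destruct (dtyp_generation typLam) as [V' [s' [_ [_ [_ [typN conv]]]]]].
apply dconv_pi_inj in conv; destruct conv as [convT convV].
assert (convT' := dconv_trans convT convU).
destruct (objN (a :: G) (T :: D) B V') as [b invb];
  [econstructor; eassumption | assumption
  | eapply represents_conv; eassumption|].
exists T, N, b; split; [reflexivity | split; [assumption|]].
apply H_equiv_lam; [apply dconv_sym, convT' | apply invb].
Qed.

Lemma object_invertible_var x : object_invertible (DVar x).
Proof.
intros G D A T ctx typ repr.
destruct (dtyp_generation typ) as [U [lookup conv]].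
destruct (conv_ctx_lookup ctx lookup) as [B [s [lookupB convU]]].
exists (EVar x); split; [constructor | | apply rst_refl].
apply (etyp_represents_El (etyp_var (conv_ctx_ewf ctx) lookupB)
  (dconv_trans (dconv_sym convU) conv) repr).
Qed.

Lemma object_invertible_u (s : sort P) : object_invertible (Cu s).
Proof.
intros G D A T ctx typ repr; destruct (dtyp_generation typ) as [s' [axs conv]].
exists (ESort s); split; [constructor | | apply rst_refl].
apply (etyp_represents_U (etyp_sort (conv_ctx_ewf ctx) axs) conv repr).
Qed.

Lemma object_invertible_Prod s1 s2 M N :
  object_invertible M -> family_invertible N ->
  object_invertible (CProd s1 s2 M N).
Proof.
intros objM famN G D C T ctx typ repr.
destruct (dtyp_generation typ) as [s3 [rl123 [typM [typN conv]]]].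
destruct (objM _ _ _ _ ctx typM (represents_U G s1)) as [a inva].
destruct (famN _ _ _ _ _ _ _ ctx typN (inverse_typed inva)
  (dconv_El s1 (inverse_dconv inva)) (represents_U (a :: G) s2))
  as [U [N' [b [-> [invb equivN]]]]].
destruct inva, invb.
exists (EPi s1 s2 a b); split; [constructor; assumption | |].
- eapply etyp_represents_U; [eapply etyp_prod|..]; eassumption.
- apply (compat_Prod (clos_rst_compatible _)); assumption.
Qed.

Lemma object_invertible_abs s1 s2 M N Q :
  object_invertible M -> family_invertible N -> family_invertible Q ->
  object_invertible (Cabs s1 s2 M N Q).
Proof.
intros objM famN famQ G D C T ctx typ repr.
destruct (dtyp_generation typ) as [s3 [rl123 [typM [typN [typQ conv]]]]].
destruct (objM _ _ _ _ ctx typM (represents_U G s1)) as [a inva].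
assert (conva := dconv_El s1 (inverse_dconv inva)).
destruct (famN _ _ _ _ _ _ _ ctx typN (inverse_typed inva) conva
  (represents_U (a :: G) s2)) as [U [N' [b [-> [invb equivN]]]]].
destruct (famQ _ _ _ _ b _ _ ctx typQ (inverse_typed inva) conva)
  as [U' [Q' [m [-> [invm equivQ]]]]].
{ apply represents_El; [apply invb|].
  apply (dconv_trans (dconv_apply_var U N')), (inverse_dconv invb). }
destruct inva, invb, invm.
exists (ELam s1 s2 a b m); split; [constructor; assumption | |].
- eapply etyp_represents_El; [eapply etyp_abs; eassumption | | eassumption].
  eapply dconv_trans; [|eassumption].
  apply dconv_El, dconv_Prod; apply H_equiv_dconv; assumption.
- apply (compat_abs (clos_rst_compatible _)); assumption.
Qed.

Lemma object_invertible_capp s1 s2 M N Q R :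
  object_invertible M -> family_invertible N ->
  object_invertible Q -> object_invertible R ->
  object_invertible (Capp s1 s2 M N Q R).
Proof.
intros objM famN objQ objR G D C T ctx typ repr.
destruct (dtyp_generation typ) as [s3 [rl123 [typM [typN [typQ [typR conv]]]]]].
destruct (objM _ _ _ _ ctx typM (represents_U G s1)) as [a inva].
destruct (famN _ _ _ _ _ _ _ ctx typN (inverse_typed inva)
  (dconv_El s1 (inverse_dconv inva)) (represents_U (a :: G) s2))
  as [U [N' [b [-> [invb equivN]]]]].
assert (typPi : etyp G (EPi s1 s2 a b) (ESort s3)) by
  (eapply etyp_prod; [eassumption | apply inva | apply invb]).
destruct (objQ _ _ (EPi s1 s2 a b) _ ctx typQ) as [q invq].
{ apply represents_El; [assumption|].
  apply dconv_Prod; [eapply inverse_dconv, inva|].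
  apply dconv_sym, H_equiv_dconv, equivN. }
destruct (objR _ _ a _ ctx typR) as [r invr].
{ apply represents_El; [apply inva | eapply inverse_dconv, inva]. }
assert (convNR := dconv_subst (inverse_dconv invb) (inverse_dconv invr)).
destruct inva, invb, invq, invr.
exists (EApp s1 s2 a b q r); split; [constructor; assumption | |].
- eapply etyp_represents_El; [eapply etyp_app; eassumption | | eassumption].
  eapply dconv_trans; [|eassumption]; rewrite <- trans_subst.
  apply dconv_El, dconv_sym.
  eapply dconv_trans; [apply dconv_beta | exact convNR].
- apply (compat_capp (clos_rst_compatible _)); assumption.
Qed.

Lemma nf_invertible M : nf M -> object_invertible M /\ family_invertible M.
Proof.
assert (family : forall N, nf N -> is_lam N = false -> family_invertible N).
{ intros N nfN not_lam G D a s B U V ctx typN.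
  destruct (nf_pi_lam ctx nfN typN) as [T [N' ->]]; discriminate. }
assert (no_object : forall N, object_form N = false -> object_invertible N).
{ intros N not_object G D A T _ typN repr.
  rewrite (object_form_of_type typN repr) in not_object; discriminate. }
induction M; intros nfM; assert (subterms := nfM); simpl in subterms;
  destruct_facts; (split; [|try (apply family; [assumption | reflexivity])]);
  try (apply no_object; reflexivity).
- apply object_invertible_var.
- intros G D A T ctx typ; destruct (nf_app_untypable ctx nfM typ).
- apply family_invertible_lam; apply IHM2; assumption.
- apply object_invertible_u.
- apply object_invertible_Prod; [apply IHM1 | apply IHM2]; assumption.
- apply object_invertible_abs;
    [apply IHM1 | apply IHM2 | apply IHM3]; assumption.
- apply object_invertible_capp;
    [apply IHM1 | apply IHM2 | apply IHM3 | apply IHM4]; assumption.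
Qed.

Lemma nf_typed_inverse G D A T M :
  trans_ctx G D -> trans_type G A T -> dtyp D M T -> nf M ->
  exists e, typed_inverse G M A e.
Proof.
intros ctx type typM nfM; apply nf_invertible in nfM; destruct nfM as [objM _].
apply (objM G D A T); auto using trans_ctx_conv_ctx, trans_type_represents.
Qed.

End Conservativity.

(** * Levels and erasure *)

Section Levels.

Variable P : pts.
Implicit Types (M N A B T : dterm P) (D : list (dterm P)).

Inductive level : Type := Object | Family | Kind.

(* Levels are syntactic because conversion may pass through untypable terms. *)
Inductive has_level : level -> dterm P -> Prop :=
| level_var x : has_level Object (DVar x)
| level_type : has_level Kind DType
| level_app l M N :
    l <> Kind -> has_level l M -> has_level Object N -> has_level l (DApp M N)
| level_lam l A M :
    l <> Kind -> has_level Family A -> has_level l M -> has_level l (DLam A M)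
| level_pi l A B :
    l <> Object -> has_level Family A -> has_level l B -> has_level l (DPi A B)
| level_U s : has_level Family (CU s)
| level_El s A : has_level Object A -> has_level Family (CEl s A)
| level_u s : has_level Object (Cu s)
| level_Prod s1 s2 A B :
    has_level Object A -> has_level Object B ->
    has_level Object (CProd s1 s2 A B)
| level_abs s1 s2 A B M :
    has_level Object A -> has_level Object B -> has_level Object M ->
    has_level Object (Cabs s1 s2 A B M)
| level_capp s1 s2 A B M N :
    has_level Object A -> has_level Object B -> has_level Object M ->
    has_level Object N -> has_level Object (Capp s1 s2 A B M N).

Lemma level_unique l l' M : has_level l M -> has_level l' M -> l = l'.
Proof.
intros levelM; revert l'; induction levelM; intros l' level';
  inversion level'; subst; auto.
Qed.

Lemma level_ren l M : has_level l M -> forall r, has_level l (dren r M).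
Proof. induction 1; simpl; intros; constructor; auto. Qed.

Lemma level_inst l M : has_level l M ->
  forall f, (forall x, has_level Object (f x)) -> has_level l (dinst f M).
Proof.
assert (level_dup : forall f, (forall x, has_level Object (f x)) ->
  forall x, has_level Object (dup f x)).
{ intros f levelf [|x]; simpl; [constructor | apply level_ren; auto]. }
induction 1; simpl; intros; auto; constructor; auto.
Qed.

Lemma level_subst l M N :
  has_level l M -> has_level Object N -> has_level l (dsubst 0 N M).
Proof.
intros levelM levelN; rewrite dsubst0E; apply level_inst; [assumption|].
intros [|x]; simpl; [assumption | constructor].
Qed.

Inductive stype : Type := base | arr (a b : stype).

(* [CU] and [CEl] have the same erasure, so that the rule on [CEl s2 (Cu s1)]
   preserves the erasure of types. *)
Fixpoint erase T : stype :=
  match T with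
  | DPi A B => arr (erase A) (erase B)
  | DLam _ M => erase M
  | DApp M _ => erase M
  | _ => base
  end.

Lemma erase_sort T : dsort T -> erase T = base.
Proof. intros [-> | ->]; reflexivity. Qed.

Lemma erase_ren M : forall r, erase (dren r M) = erase M.
Proof. induction M; simpl; intros; auto; f_equal; auto. Qed.

Lemma erase_inst l M :
  has_level l M -> l <> Object -> forall f, erase (dinst f M) = erase M.
Proof.
induction 1; simpl; intros; try congruence; auto; f_equal; auto.
match goal with IH : Family <> Object -> _ |- _ => apply IH; discriminate end.
Qed.

Lemma level_dred l M M' : has_level l M -> dred M M' ->
  has_level l M' /\ (l <> Object -> erase M' = erase M).
Proof.
intros levelM; revert M'; induction levelM; intros Q step; invert_dred step;
  repeat match goal with
  | IH : forall M', dred ?M M' -> _, stepM : dclos _ ?M _ |- _ =>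
      destruct (IH _ stepM) as [? ?]; clear IH
  end;
  try (split; [constructor; assumption | simpl; intros; auto; congruence]).
- match goal with level_fun : has_level _ (DLam _ _) |- _ =>
    inversion level_fun; subst end.
  split; [apply level_subst; assumption|].
  intros not_object; simpl; rewrite dsubst0E; eapply erase_inst; eassumption.
- split; [constructor; assumption|].
  intros not_object; simpl; f_equal.
  match goal with erase_eq : Family <> Object -> _ |- _ =>
    apply erase_eq; discriminate end.
- split; [constructor; assumption | intros not_object; simpl; f_equal; auto].
- match goal with level_abs : has_level _ (Cabs _ _ _ _ _) |- _ =>
    inversion level_abs; subst end.
  split; [constructor; auto; discriminate | congruence].
Qed.

Lemma level_dreds l M M' : dreds M M' -> has_level l M ->
  has_level l M' /\ (l <> Object -> erase M' = erase M).
Proof.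
induction 1 as [M N step| |M N T _ IHM _ IHN]; intros levelM; auto.
- apply level_dred; assumption.
- destruct (IHM levelM) as [levelN eraseM], (IHN levelN) as [levelT eraseN].
  split; [assumption | intros; rewrite eraseN, eraseM; auto].
Qed.

Lemma level_dconv M N l l' : dconv M N -> has_level l M -> has_level l' N ->
  l = l' /\ (l <> Object -> erase M = erase N).
Proof.
intros conv levelM levelN; destruct (church_rosser conv) as [Q [redM redN]].
destruct (level_dreds redM levelM) as [levelQ eraseM],
  (level_dreds redN levelN) as [levelQ' eraseN].
assert (l = l') by (eapply level_unique; eassumption); subst l'.
split; [reflexivity | intros not_object; rewrite <- eraseM, <- eraseN; auto].
Qed.

Lemma dconv_kind_no_level M l : dconv DKind M -> ~ has_level l M.
Proof.
intros conv levelM.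
destruct (level_dreds (dconv_kind_dreds conv) levelM) as [level_kind _].
inversion level_kind.
Qed.

Lemma level_trans (e : eterm P) : has_level Object (trans e).
Proof.
induction e; simpl; repeat constructor; try assumption; discriminate.
Qed.

Definition classifies (l : level) T : Prop :=
  match l with
  | Object => has_level Family T
  | Family => has_level Kind T
  | Kind => T = DKind
  end.

Definition stratified M T : Prop := exists l, has_level l M /\ classifies l T.

Lemma stratified_type M : stratified M DType -> has_level Family M.
Proof.
intros [[| |] [levelM above]]; simpl in above;
  [inversion above | assumption | discriminate].
Qed.

Lemma stratified_object M T :
  stratified M T -> has_level Family T -> has_level Object M.
Proof.
intros [[| |] [levelM above]] levelT; simpl in above.
- assumption.
- discriminate (level_unique levelT above).
- subst; inversion levelT.
Qed.

Lemma stratified_sort M T :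
  stratified M T -> dsort T -> exists l, l <> Object /\ has_level l M.
Proof.
intros [l [levelM above]] sortT; exists l; split; [|assumption].
intros ->; simpl in above; destruct sortT as [-> | ->]; inversion above.
Qed.

Lemma stratified_conv M A B s :
  stratified M A -> stratified B s -> dconv A B ->
  stratified M B /\ erase A = erase B.
Proof.
intros [l [levelM above]] [l' [levelB _]] conv; unfold stratified.
destruct l; simpl in above;
  [| |subst; destruct (dconv_kind_no_level conv levelB)];
  destruct (level_dconv conv above levelB) as [<- erase_eq];
  split; [exists Object| |exists Family|]; auto; apply erase_eq; discriminate.
Qed.

Lemma stratified_pi A B s :
  dsort s -> has_level Family A -> stratified B s -> stratified (DPi A B) s.
Proof.
intros sort_s levelA typB.
destruct (stratified_sort typB sort_s) as [l [not_object levelB]].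
destruct typB as [l' [levelB' above]]; exists l'; split; [|assumption].
rewrite (level_unique levelB' levelB) in *; constructor; assumption.
Qed.

Lemma stratified_lam A B M s :
  dsort s -> has_level Family A -> stratified B s -> stratified M B ->
  stratified (DLam A M) (DPi A B).
Proof.
intros sort_s levelA typB [l [levelM above]].
destruct (stratified_sort typB sort_s) as [l' [not_object levelB]].
exists l; destruct l; simpl in *; [| |subst; inversion levelB];
  split; constructor; auto; discriminate.
Qed.

Lemma stratified_app A B M N :
  stratified M (DPi A B) -> stratified N A ->
  stratified (DApp M N) (dsubst 0 N B).
Proof.
intros [l [levelM above]] typN.
exists l; destruct l; simpl in *; [| |discriminate]; inversion above; subst;
  (assert (levelN : has_level Object N) by eauto using stratified_object);
  split; try apply level_subst; try constructor; auto; discriminate.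
Qed.

Lemma stratified_pi_codomain A B M :
  stratified M (DPi A B) -> exists l, l <> Object /\ has_level l B.
Proof.
intros [l [_ above]]; destruct l; simpl in above; [| |discriminate];
  inversion above; subst; eauto.
Qed.

Lemma level_darrow A s1 s2 :
  has_level Object A -> has_level Family (darrow (CEl s1 A) (CU s2)).
Proof. intros; repeat constructor; [discriminate | assumption]. Qed.

Lemma level_pi_apply_var A B s1 s2 :
  has_level Object A -> has_level Object B ->
  has_level Family (DPi (CEl s1 A) (CEl s2 (DApp (dren S B) (DVar 0)))).
Proof. intros; repeat constructor; auto using level_ren; discriminate. Qed.

Lemma dtyp_stratified D M T :
  dtyp D M T -> Forall (has_level Family) D -> stratified M T.
Proof.
induction 1; intros levelD.
- exists Kind; split; [constructor | reflexivity].
- exists Object; split; [constructor|]; apply level_ren.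
  rewrite Forall_forall in levelD; eapply levelD, nth_error_In; eassumption.
- eapply stratified_conv; eauto.
- eapply stratified_pi; eauto using stratified_type.
- eapply stratified_lam; eauto using stratified_type.
- eapply stratified_app; eauto.
- exists Family; split; constructor.
- exists Family; split; constructor; eauto using stratified_object, level_U.
- exists Object; split; constructor.
- assert (objA : has_level Object A) by eauto using stratified_object, level_U.
  exists Object; split; constructor;
    eauto using stratified_object, level_darrow.
- assert (objA : has_level Object A) by eauto using stratified_object, level_U.
  assert (objB : has_level Object B) by
    eauto using stratified_object, level_darrow.
  exists Object; split; repeat constructor; auto.
  eauto using stratified_object, level_pi_apply_var.
- assert (objA : has_level Object A) by eauto using stratified_object, level_U.
  assert (objB : has_level Object B) by
    eauto using stratified_object, level_darrow.
  assert (objN : has_level Object N) by eauto using stratified_object, level_El.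
  exists Object; split; repeat constructor; auto; try discriminate.
  eauto using stratified_object, level_El, level_Prod.
Qed.

Lemma trans_ctx_level (G : list (eterm P)) D :
  trans_ctx G D -> Forall (has_level Family) D.
Proof. induction 1; repeat constructor; auto using level_trans. Qed.

End Levels.

(** * Beta-normalization *)

Section Normalization.

Variable P : pts.
Implicit Types (M N A B T : dterm P) (D : list (dterm P)) (G : nat -> stype).

Inductive simply_typed : (nat -> stype) -> dterm P -> stype -> Prop :=
| simply_typed_var G x a : G x = a -> simply_typed G (DVar x) a
| simply_typed_type G : simply_typed G DType base
| simply_typed_app G M N a b :
    simply_typed G M (arr a b) -> simply_typed G N a ->
    simply_typed G (DApp M N) b
| simply_typed_lam G A M a b :
    simply_typed G A base -> simply_typed (scons a G) M b ->
    simply_typed G (DLam A M) (arr a b)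
| simply_typed_pi G A B a :
    simply_typed G A base -> simply_typed (scons a G) B base ->
    simply_typed G (DPi A B) base
| simply_typed_U G s : simply_typed G (CU s) base
| simply_typed_El G s A : simply_typed G A base -> simply_typed G (CEl s A) base
| simply_typed_u G s : simply_typed G (Cu s) base
| simply_typed_Prod G s1 s2 A B :
    simply_typed G A base -> simply_typed G B (arr base base) ->
    simply_typed G (CProd s1 s2 A B) base
| simply_typed_abs G s1 s2 A B M :
    simply_typed G A base -> simply_typed G B (arr base base) ->
    simply_typed G M (arr base base) -> simply_typed G (Cabs s1 s2 A B M) base
| simply_typed_capp G s1 s2 A B M N :
    simply_typed G A base -> simply_typed G B (arr base base) ->
    simply_typed G M base -> simply_typed G N base ->
    simply_typed G (Capp s1 s2 A B M N) base.

Definition erases_ctx D G : Prop :=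
  forall x A, nth_error D x = Some A -> G x = erase A.

Lemma erases_ctx_cons D G A :
  erases_ctx D G -> erases_ctx (A :: D) (scons (erase A) G).
Proof. intros erasesD [|x] B lookup; simpl in *; [congruence | auto]. Qed.

Lemma dtyp_simply_typed D M T : dtyp D M T ->
  Forall (has_level Family) D ->
  forall G, erases_ctx D G -> simply_typed G M (erase T).
Proof.
induction 1 as [|D x A|D M A B s typM IHM _ typB _ conv
  |D A B s sort_s typA IHA _ IHB|D A B M s _ typA IHA _ _ _ IHM
  |D A B M N typM IHM _ IHN| | | | | |]; intros levelD env erasesD; simpl in *;
  try (assert (levelA : has_level Family A) by
    eauto using stratified_type, dtyp_stratified;
    assert (erasesA := erases_ctx_cons (A := A) erasesD));
  try (constructor; auto; fail).
- rewrite erase_ren; constructor; auto.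
- destruct (stratified_conv (dtyp_stratified typM levelD)
    (dtyp_stratified typB levelD) conv) as [_ <-]; auto.
- rewrite (erase_sort sort_s) in *; econstructor; eauto.
- destruct (stratified_pi_codomain (dtyp_stratified typM levelD))
    as [l [not_object levelB]].
  rewrite dsubst0E, (erase_inst levelB not_object); econstructor; eauto.
Qed.

Lemma simply_typed_ren G M a : simply_typed G M a ->
  forall G' r, (forall x, G' (r x) = G x) -> simply_typed G' (dren r M) a.
Proof.
assert (typed_up : forall G G' (a : stype) r, (forall x, G' (r x) = G x) ->
  forall x, scons a G' (up_ren r x) = scons a G x).
{ intros G0 G' a0 r typed_r [|x]; simpl; auto. }
induction 1; simpl; intros; try (econstructor; eauto; fail).
constructor; congruence.
Qed.

Fixpoint stype_size (a : stype) : nat :=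
  match a with base => 0 | arr a b => S (stype_size a + stype_size b) end.

Definition normal_typed G M a : Prop := nf M /\ simply_typed G M a.

Record normal_inst (n : nat) G G' (f : nat -> dterm P) : Prop := {
  normal_inst_typed x : normal_typed G' (f x) (G x);
  normal_inst_size x : is_lam (f x) = true -> stype_size (G x) <= n }.

Lemma normal_inst_up n G G' f a :
  normal_inst n G G' f -> normal_inst n (scons a G) (scons a G') (dup f).
Proof.
intros [typedf sizef]; constructor; intros [|x]; simpl; rewrite ?is_lam_ren;
  try discriminate; auto.
- split; [exact I | constructor; reflexivity].
- destruct (typedf x) as [nfx typx]; split; [apply nf_ren, nfx|].
  eapply simply_typed_ren; [exact typx | reflexivity].
Qed.

Lemma normal_inst_scons G N a :
  normal_typed G N a ->
  normal_inst (stype_size a) (scons a G) G (scons N (@DVar P)).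
Proof.
intros normalN; constructor; intros [|x]; simpl; try discriminate; auto.
split; [exact I | constructor; reflexivity].
Qed.

(* [R] says when applying the normal form may create a redex. *)
Definition normalizes (R : Prop) G M a : Prop :=
  exists M', dbetas M M' /\ normal_typed G M' a /\ (is_lam M' = true -> R).

Lemma normalizes_normal G M a (R : Prop) :
  normal_typed G M a -> (is_lam M = true -> R) -> normalizes R G M a.
Proof. intros; exists M; split; [apply rt_refl | auto]. Qed.

Lemma normalizes_weaken (R R' : Prop) G M a :
  (R -> R') -> normalizes R G M a -> normalizes R' G M a.
Proof. intros weaken [N [redM [normalN lamN]]]; exists N; auto. Qed.

Lemma normalizes_dbetas G M N a (R : Prop) :
  dbetas M N -> normalizes R G N a -> normalizes R G M a.
Proof.
intros redM [Q [redN normalQ]]; exists Q; split; [|assumption].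
eapply rt_trans; eassumption.
Qed.

Ltac normalize_subterms :=
  intros; unfold normalizes, normal_typed in *; destruct_facts;
  eexists; split; [apply clos_rt_compatible; eassumption|];
  split; [split; [simpl; auto | econstructor; eassumption]|];
  auto; discriminate.

Lemma normalizes_lam G A M a b (RA RM R : Prop) :
  normalizes RA G A base -> normalizes RM (scons a G) M b -> R ->
  normalizes R G (DLam A M) (arr a b).
Proof. normalize_subterms. Qed.

Lemma normalizes_pi G A B a (RA RB R : Prop) :
  normalizes RA G A base -> normalizes RB (scons a G) B base ->
  normalizes R G (DPi A B) base.
Proof. normalize_subterms. Qed.

Lemma normalizes_El G s A (RA R : Prop) :
  normalizes RA G A base -> normalizes R G (CEl s A) base.
Proof. normalize_subterms. Qed.

Lemma normalizes_Prod G s1 s2 A B (RA RB R : Prop) :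
  normalizes RA G A base -> normalizes RB G B (arr base base) ->
  normalizes R G (CProd s1 s2 A B) base.
Proof. normalize_subterms. Qed.

Lemma normalizes_abs G s1 s2 A B M (RA RB RM R : Prop) :
  normalizes RA G A base -> normalizes RB G B (arr base base) ->
  normalizes RM G M (arr base base) -> normalizes R G (Cabs s1 s2 A B M) base.
Proof. normalize_subterms. Qed.

Lemma normalizes_capp G s1 s2 A B M N (RA RB RM RN R : Prop) :
  normalizes RA G A base -> normalizes RB G B (arr base base) ->
  normalizes RM G M base -> normalizes RN G N base ->
  normalizes R G (Capp s1 s2 A B M N) base.
Proof. normalize_subterms. Qed.

(* Hereditary substitution: instantiating variables by abstractions of types of
   size at most [n] only creates abstractions of such types. *)
Definition hereditary (n : nat) : Prop :=
  forall G M b, normal_typed G M b ->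
  forall G' f, normal_inst n G G' f ->
  normalizes (is_lam M = true \/ stype_size b <= n) G' (dinst f M) b.

Lemma normalizes_app G M N a b (R RN : Prop) :
  normalizes R G M (arr a b) -> (R -> hereditary (stype_size a)) ->
  normalizes RN G N a -> normalizes R G (DApp M N) b.
Proof.
intros [M' [redM [[nfM typM] lamM]]] hered [N' [redN [normalN _]]].
apply normalizes_dbetas with (DApp M' N');
  [apply clos_rt_compatible; assumption|].
destruct (is_lam M') eqn:eq_lam.
- assert (holds : R) by auto.
  destruct M' as [| | | |A M'| | | | | | |]; try discriminate.
  inversion typM; subst; destruct nfM as [_ nfM'].
  destruct (hered holds (scons a G) M' b) with (2 := normal_inst_scons normalN)
    as [Q [redQ [normalQ _]]]; [split; assumption|].
  apply normalizes_dbetas with (dsubst 0 N' M');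
    [apply rt_step; constructor; constructor|].
  exists Q; rewrite dsubst0E; auto.
- destruct normalN as [nfN typN]; apply normalizes_normal; [|discriminate].
  repeat split; auto; econstructor; eassumption.
Qed.

Lemma hereditary_substitution n : hereditary n.
Proof.
induction n as [n IHn] using lt_wf_ind.
intros G M b [nfM typM]; revert nfM.
induction typM as [G x b eqb|G|G M N a b _ IHM _ IHN|G A M a b _ IHA _ IHM
  |G A B a _ IHA _ IHB|G s|G s A _ IHA|G s|G s1 s2 A B _ IHA _ IHB
  |G s1 s2 A B M _ IHA _ IHB _ IHM
  |G s1 s2 A B M N _ IHA _ IHB _ IHM _ IHN]; simpl; intros nfM G' f instf;
  destruct_facts;
  try (apply normalizes_normal;
    [split; [exact I | constructor] | discriminate]).
- subst b; destruct instf as [typedf sizef]; apply normalizes_normal; auto.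
- assert (bound : is_lam M = true \/ stype_size (arr a b) <= n ->
    stype_size a < n /\ stype_size b <= n) by
    (simpl; intuition (congruence || lia)).
  apply normalizes_weaken with (is_lam M = true \/ stype_size (arr a b) <= n).
  + intros lamM; apply bound in lamM; tauto.
  + eapply normalizes_app; eauto.
    intros lamM; apply IHn, bound, lamM.
- eapply normalizes_lam; eauto using normal_inst_up.
- eapply normalizes_pi; eauto using normal_inst_up.
- eapply normalizes_El; eauto.
- eapply normalizes_Prod; eauto.
- eapply normalizes_abs; eauto.
- eapply normalizes_capp; eauto.
Qed.

Lemma simply_typed_normalizes G M a :
  simply_typed G M a -> normalizes True G M a.
Proof.
induction 1;
  try (apply normalizes_normal; [split; [exact I | constructor; assumption]
    | discriminate]).
- eapply normalizes_app; eauto using hereditary_substitution.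
- eapply normalizes_lam; eauto.
- eapply normalizes_pi; eauto.
- eapply normalizes_El; eauto.
- eapply normalizes_Prod; eauto.
- eapply normalizes_abs; eauto.
- eapply normalizes_capp; eauto.
Qed.

Lemma dtyp_normalizes D M T : dtyp D M T -> Forall (has_level Family) D ->
  exists N, dbetas M N /\ beta_normal N.
Proof.
intros typM levelD.
set (G := fun x =>
  match nth_error D x with Some A => erase A | None => base end).
assert (erasesD : erases_ctx D G) by
  (intros x A lookup; unfold G; rewrite lookup; reflexivity).
destruct (simply_typed_normalizes (dtyp_simply_typed typM levelD erasesD))
  as [N [redM [[nfN _] _]]].
exists N; split; [assumption | apply nf_beta_normal, nfN].
Qed.

End Normalization.

Theorem mainTheorem4 (P : pts) (hP : functional P) :
  (forall (G : list (eterm P)) (A : eterm P) (D : list (dterm P)) (T : dterm P),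
     eistype G A -> trans_ctx G D -> trans_type G A T ->
     bijection_mod
       (fun M => etyp G M A)
       (fun M => dtyp D M T /\ beta_normal M)
       (@H_equiv P) (@trans P) (@inv P)
     /\ (forall M, dtyp D M T -> exists N, dbetas M N /\ beta_normal N))
  /\ (forall (x : nat) (M N : eterm P),
        dsubst x (trans N) (trans M) = trans (esubst x N M))
  /\ (forall M N : eterm P, ereds M N <-> dreds (trans M) (trans N)).
Proof.
split; [|split; [exact (@trans_subst P) | exact (@ereds_iff_dreds P)]].
intros G A D T _ ctx type.
assert (inverse : forall M, dtyp D M T /\ beta_normal M ->
  exists e, inv M = Some e /\ typed_inverse G M A e).
{ intros M [typM normal].
  destruct (nf_typed_inverse hP ctx type typM (beta_normal_nf normal))
    as [e inve].
  exists e; split; [apply invertible_inv, inve | assumption]. }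
split; [repeat split|].
- eapply trans_sound; eassumption.
- apply nf_beta_normal, nf_trans.
- intros M normalM; destruct (inverse M normalM) as [e [invM []]]; eauto.
- intros M M' _ _; apply inv_H_equiv.
- intros e _; apply inv_trans.
- intros M e normalM invM; destruct (inverse M normalM) as [e' [invM' inve']].
  replace e with e' by congruence; apply inve'.
- intros M typM; apply (dtyp_normalizes typM (trans_ctx_level ctx)).
Qed.
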